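(* Let $\mathbb F$ be an algebraically closed field of characteristic zero, let $\mathcal S\subset\mathbb Z$ be a finite set of steps, each step $i\in\mathcal S$ having a weight $w_i\in\mathbb F\setminus\{0\}$, and let $S(x)=\sum_{i\in\mathcal S}w_ix^i$. Let $-m$ (resp. $M$) be the smallest (resp. largest) element of $\mathcal S$, and assume $m\ge0$ and $M>0$. Let $K(x)=1-tS(x)$ and $\bar x=1/x$. The equation $S(X)=S(x)$ (when solved for $X$) admits $m+M$ roots, which can be taken in the field of Puiseux series in $\bar x$ with coefficients in $\mathbb F$. Exactly $m$ of these roots, denoted $x_1,\ldots,x_m$, contain no positive power of $x$ (and, in fact, have no constant term either). The generating function $Q(x)\equiv Q(x;t)$ of weighted walks on $\mathbb N$, starting from $0$ and with steps in $\mathcal S$, is $$Q(x)=[x^{\ge}]\frac{\prod_{j=1}^m(1-\bar x\,x_j)}{K(x)},$$ where the right-hand side is expanded first in $t$, then in $\bar x$. If the largest step of $\mathcal S$ is $M=1$, the series on the right-hand side (before extraction of the non-negative part) is rational, and $$Q(x)=[x^{\ge}]\frac{S'(x)}{w_1K(x)}.$$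
   Context: $\mathbb N=\{0,1,2,\ldots\}$; $x$ and $t$ are indeterminates, algebraically independent over $\mathbb F$. The weight of a walk is the product of the weights of its steps, and $Q(x;t)=\sum_{i,n\ge0}q(i;n)x^it^n$, where $q(i;n)$ is the sum of the weights of the $n$-step walks with steps in $\mathcal S$ that start at $0$, end at $i$ and never leave $\mathbb N$. Puiseux series in $\bar x$ are Laurent series in a fractional power $\bar x^{1/p}$. For a power series in $t$ whose coefficients are (fractional) Laurent series in $\bar x$, $[x^\ge]$ keeps, in the coefficient of each $t^n$, only the terms with non-negative exponent of $x$. *)

(* Defs.v *)
From HB Require Import structures.
From mathcomp Require Import all_boot all_order all_algebra.
From mathcomp Require Import finmap.
From mathcomp Require Import boolp classical_sets functions cardinality fsbigop.
From mathcomp Require Import zify.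

Set Implicit Arguments.
Unset Strict Implicit.
Unset Printing Implicit Defensive.

Import Order.TTheory GRing.Theory Num.Theory.

Local Open Scope ring_scope.

(* formal power series in t *)
Record fps (R : Type) := Fps { fps_coef : nat -> R }.

Notation "a ``_ n" := (fps_coef a n)
  (at level 3, n at level 2, left associativity, format "a ``_ n") : ring_scope.

Lemma fpsP (R : Type) (a b : fps R) : (forall n, a``_n = b``_n) -> a = b.
Proof. by case: a => a; case: b => b /= /funext ->. Qed.

HB.instance Definition _ (R : Type) := gen_eqMixin (fps R).
HB.instance Definition _ (R : Type) := gen_choiceMixin (fps R).

Section FpsZmod.
Variable R : zmodType.
Implicit Types a b c : fps R.

Definition fps_zero : fps R := Fps (fun=> 0).
Definition fps_opp a := Fps (fun n => - a``_n).
Definition fps_add a b := Fps (fun n => a``_n + b``_n).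

Lemma fps_addA : associative fps_add.
Proof. by move=> a b c; apply: fpsP => n /=; rewrite addrA. Qed.
Lemma fps_addC : commutative fps_add.
Proof. by move=> a b; apply: fpsP => n /=; rewrite addrC. Qed.
Lemma fps_add0 : left_id fps_zero fps_add.
Proof. by move=> a; apply: fpsP => n /=; rewrite add0r. Qed.
Lemma fps_addN : left_inverse fps_zero fps_opp fps_add.
Proof. by move=> a; apply: fpsP => n /=; rewrite addNr. Qed.

HB.instance Definition _ :=
  GRing.isZmodule.Build (fps R) fps_addA fps_addC fps_add0 fps_addN.

Lemma fps_coefD a b n : (a + b)``_n = a``_n + b``_n. Proof. by []. Qed.
Lemma fps_coef0 n : (0 : fps R)``_n = 0. Proof. by []. Qed.
End FpsZmod.

Section FpsRing.
Variable R : comNzRingType.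
Implicit Types (a b c : fps R) (p q : {poly R}).

Definition fpsC (x : R) : fps R := Fps (fun n => if n == 0%N then x else 0).
(* the indeterminate t *)
Definition fpsX : fps R := Fps (fun n => (n == 1%N)%:R).
Definition fps_mul a b :=
  Fps (fun n => \sum_(i < n.+1) a``_i * b``_(n - i)).

Definition fps_trunc n a : {poly R} := \poly_(i < n.+1) a``_i.

Lemma fps_mul_trunc n k a b : (k <= n)%N ->
  (fps_mul a b)``_k = (fps_trunc n a * fps_trunc n b)`_k.
Proof.
move=> kn; rewrite coefM /=; apply: eq_bigr => i _; rewrite !coef_poly !ltnS.
by rewrite (leq_trans (leq_ord i) kn) (leq_trans (leq_subr _ _) kn).
Qed.

Lemma fps_mulC : commutative fps_mul.
Proof.
by move=> a b; apply: fpsP => n; rewrite !(fps_mul_trunc _ _ (leqnn n)) mulrC.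
Qed.

Lemma fps_mulA : associative fps_mul.
Proof.
move=> a b c; apply: fpsP => n.
transitivity ((fps_trunc n a * (fps_trunc n b * fps_trunc n c))`_n).
  rewrite coefM; apply: eq_bigr => i _; rewrite coef_poly ltn_ord.
  by rewrite (@fps_mul_trunc n)// leq_subr.
rewrite mulrA coefM; apply: eq_bigr => i _.
by rewrite (@fps_mul_trunc n) ?leq_ord// coef_poly ltnS leq_subr.
Qed.

Lemma fps_mul1 : left_id (fpsC 1) fps_mul.
Proof.
move=> a; apply: fpsP => n /=; rewrite big_ord_recl/= mul1r subn0.
by rewrite big1 ?addr0// => i _; rewrite mul0r.
Qed.

Lemma fps_mulDl : left_distributive fps_mul +%R.
Proof.
move=> a b c; apply: fpsP => n /=; rewrite -big_split/=.
by apply: eq_bigr => i _; rewrite mulrDl.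
Qed.

Lemma fps_oner_neq0 : fpsC 1 != 0.
Proof.
by apply/eqP => /(congr1 (fun a => a``_0)) /eqP; rewrite /= oner_eq0.
Qed.

HB.instance Definition _ := GRing.Zmodule_isComNzRing.Build (fps R)
  fps_mulA fps_mulC fps_mul1 fps_mulDl fps_oner_neq0.

Lemma fps_coefM a b n :
  (a * b)``_n = \sum_(i < n.+1) a``_i * b``_(n - i).
Proof. by []. Qed.

Definition fps_of_poly (p : {poly R}) : fps R := Fps (fun n => p`_n).
End FpsRing.

Section FpsUnit.
Variable R : comUnitRingType.
Implicit Types a b : fps R.

Fixpoint fps_inv_seq a n : seq R :=
  if n is n'.+1 then
    let s := fps_inv_seq a n' in
    rcons s (- (a``_0)^-1 * \sum_(i < n) a``_(n - i) * s`_i)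
  else [:: (a``_0)^-1].

Lemma size_fps_inv_seq a n : size (fps_inv_seq a n) = n.+1.
Proof. by elim: n => //= n IH; rewrite size_rcons IH. Qed.

Lemma fps_inv_seq_stable a n i : (i <= n)%N ->
  (fps_inv_seq a n)`_i = (fps_inv_seq a i)`_i.
Proof.
elim: n => [|n IH]; first by rewrite leqn0 => /eqP ->.
rewrite leq_eqVlt => /predU1P[-> //|]; rewrite ltnS => le_in.
by rewrite /= nth_rcons size_fps_inv_seq ltnS le_in IH.
Qed.

Definition fps_unit : {pred fps R} := fun a => a``_0 \is a GRing.unit.

Definition fps_inv a : fps R :=
  if a \in fps_unit then Fps (fun n => (fps_inv_seq a n)`_n) else a.

Lemma fps_mulVx : {in fps_unit, left_inverse 1 fps_inv *%R}.
Proof.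
move=> a ua; have u0 : a``_0 \is a GRing.unit by [].
rewrite mulrC; apply: fpsP => -[|n]; rewrite fps_coefM /fps_inv ua.
  by rewrite big_ord1 /= divrr.
rewrite big_ord_recl /= subn0 nth_rcons size_fps_inv_seq ltnn eqxx.
rewrite mulrA mulrN divrr// mulN1r.
rewrite (reindex_inj rev_ord_inj) /= addrC; apply/eqP.
rewrite subr_eq0; apply/eqP; apply: eq_bigr => i _.
rewrite /= !subSS /bump /= add1n.
rewrite (@fps_inv_seq_stable a n) ?leq_subr//.
by rewrite subSn ?leq_subr// subKn// leq_ord.
Qed.

Lemma fps_unitPl a b : b * a = 1 -> fps_unit a.
Proof.
move=> /(congr1 (fun c => c``_0)); rewrite fps_coefM big_ord1 /= => ba.
by rewrite /fps_unit; apply/unitrPr; exists (b``_0); rewrite mulrC.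
Qed.

Lemma fps_inv_out : {in [predC fps_unit], fps_inv =1 id}.
Proof. by move=> a; rewrite inE /= /fps_inv => /negbTE ->. Qed.

HB.instance Definition _ := GRing.ComNzRing_hasMulInverse.Build (fps R)
  fps_mulVx fps_unitPl fps_inv_out.
End FpsUnit.

(* Exponents are exponents of x: the support lies in (1/p) Z and is bounded
   above, so that these are the Laurent series in x^(-1/p). *)
Definition puiseux_supp (F : nmodType) (a : rat -> F) : Prop :=
  exists (p : nat) (N : int), (0 < p)%N /\
    forall q, a q != 0 -> exists2 k : int, k <= N & q = k%:~R / p%:R.

Record puiseux (F : nmodType) := Puiseux {
  pcoef : rat -> F;
  pcoef_supp : puiseux_supp pcoef }.

Notation "a @_ q" := (pcoef a q)
  (at level 3, q at level 2, left associativity, format "a @_ q") : ring_scope.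

Lemma puiseuxP (F : nmodType) (a b : puiseux F) :
  (forall q, a@_q = b@_q) -> a = b.
Proof.
case: a => a ha; case: b => b hb /= /funext eq_ab.
by case: _ / eq_ab in hb *; rewrite (Prop_irrelevance ha hb).
Qed.

HB.instance Definition _ (F : nmodType) := gen_eqMixin (puiseux F).
HB.instance Definition _ (F : nmodType) := gen_choiceMixin (puiseux F).

Section PuiseuxOfFps.
Variable F : nmodType.
Implicit Types (A : fps F) (p : nat) (N : int).

(* x^(N/p) A(x^(-1/p)) *)
Definition fps_puiseux_fun p N A (q : rat) : F :=
  let r := q * p%:R in
  if (denq r == 1) && (numq r <= N) then A``_`|N - numq r|%N else 0.

Lemma fps_puiseux_funE p N A j : (0 < p)%N ->
  fps_puiseux_fun p N A ((N - j%:Z)%:~R / p%:R) = A``_j.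
Proof.
move=> p0; rewrite /fps_puiseux_fun divfK ?pnatr_eq0 -?lt0n//.
by rewrite denq_int numq_int eqxx gerBl// opprB addrC subrK.
Qed.

Lemma fps_puiseux_fun_neq0 p N A q : (0 < p)%N ->
  fps_puiseux_fun p N A q != 0 -> exists j : nat, q = (N - j%:Z)%:~R / p%:R.
Proof.
move=> p0; rewrite /fps_puiseux_fun; case: ifP; last by rewrite eqxx.
move=> /andP[/eqP d1 le_N] _; exists `|N - numq (q * p%:R)|%N.
rewrite gez0_abs ?subr_ge0// opprB addrC subrK.
have p0' : (p%:R : rat) != 0 by rewrite pnatr_eq0 -lt0n.
by apply: (mulIf p0'); rewrite divfK// -[LHS]divq_num_den d1 divr1.
Qed.

Lemma fps_puiseux_supp p N A : (0 < p)%N -> puiseux_supp (fps_puiseux_fun p N A).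
Proof.
move=> p0; exists p, N; split=> // q /(fps_puiseux_fun_neq0 p0)[j ->].
by exists (N - j%:Z) => //; rewrite gerBl.
Qed.

(* the denominator is p.+1, which avoids carrying a positivity proof *)
Definition fps_puiseux p N A : puiseux F :=
  Puiseux (fps_puiseux_supp N A (ltn0Sn p)).

Lemma fps_puiseuxE p N A j :
  (fps_puiseux p N A)@_((N - j%:Z)%:~R / p.+1%:R) = A``_j.
Proof. exact: fps_puiseux_funE. Qed.

Lemma fps_puiseux_neq0 p N A q :
  (fps_puiseux p N A)@_q != 0 -> exists j : nat, q = (N - j%:Z)%:~R / p.+1%:R.
Proof. exact: fps_puiseux_fun_neq0. Qed.

Lemma puiseux_repr (a : puiseux F) p N :
  (forall q, a@_q != 0 -> exists2 k : int, k <= N & q = k%:~R / p.+1%:R) ->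
  a = fps_puiseux p N (Fps (fun j => a@_((N - j%:Z)%:~R / p.+1%:R))).
Proof.
move=> aP; apply: puiseuxP => q.
have [[j ->]|nj] := pselect (exists j : nat, q = (N - j%:Z)%:~R / p.+1%:R).
  by rewrite fps_puiseuxE.
transitivity (0 : F); last first.
  by apply/esym/eqP; apply: contrapT => /negP /fps_puiseux_neq0.
apply/eqP; apply: contrapT => /negP /aP[k kN qk]; apply: nj.
by exists `|N - k|%N; rewrite gez0_abs ?subr_ge0// opprB addrC subrK.
Qed.

Lemma puiseux_suppW p p' N N' (q : rat) : (0 < p)%N -> (0 < p')%N ->
  (p %| p')%N -> (N%:~R / p%:R : rat) <= N'%:~R / p'%:R ->
  (exists2 k : int, k <= N & q = k%:~R / p%:R) ->
  (exists2 k : int, k <= N' & q = k%:~R / p'%:R).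
Proof.
move=> p0 p'0 /dvdnP[d pd] leN [k kN ->].
have P0 : (0 : rat) < p%:R by rewrite ltr0n.
have P'0 : (0 : rat) < p'%:R by rewrite ltr0n.
have d0 : (d%:R : rat) != 0.
  by rewrite pnatr_eq0; apply: contraTneq p'0 => d0; rewrite pd d0.
exists (k * d%:Z).
  rewrite -(ler_int rat) -(ler_pM2r (_ : 0 < p'%:R^-1)) ?invr_gt0//.
  apply: le_trans leN; rewrite pd natrM rmorphM/= -pmulrn.
  rewrite [d%:R * _]mulrC -mulf_div divff// mulr1.
  by rewrite ler_pM2r ?invr_gt0// ler_int.
by rewrite pd natrM rmorphM/= -pmulrn [d%:R * _]mulrC -mulf_div divff// mulr1.
Qed.

Lemma puiseux_common (s : seq (puiseux F)) : exists p N,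
  forall a, a \in s -> exists A, a = fps_puiseux p N A.
Proof.
suff [p [N sP]] : exists (p : nat) (N : int), forall a, a \in s ->
    forall q, a@_q != 0 -> exists2 k : int, k <= N & q = k%:~R / p.+1%:R.
  by exists p, N => a /sP/puiseux_repr aE; eexists; exact: aE.
elim: s => [|a s [p [N IH]]]; first by exists 0%N, 0.
have [p' [N' [p'0 aP]]] := pcoef_supp a.
pose N1 : int := Num.max (N * p'%:Z) (N' * p.+1%:Z).
exists (p.+1 * p').-1, N1.
have pp0 : (0 < p.+1 * p')%N by rewrite muln_gt0.
have hN : ((N%:~R / p.+1%:R : rat) <= N1%:~R / (p.+1 * p')%:R)
   /\ ((N'%:~R / p'%:R : rat) <= N1%:~R / (p.+1 * p')%:R).
  have -> : N%:~R / p.+1%:R = (N * p'%:Z)%:~R / (p.+1 * p')%:R :> rat.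
    by rewrite natrM rmorphM/= -pmulrn -mulf_div divff ?mulr1// pnatr_eq0 -lt0n.
  have -> : N'%:~R / p'%:R = (N' * p.+1%:Z)%:~R / (p.+1 * p')%:R :> rat.
    rewrite mulnC natrM rmorphM/= -pmulrn -mulf_div divff ?mulr1//.
    by rewrite pnatr_eq0.
  rewrite !ler_pM2r ?invr_gt0 ?ltr0n// !ler_int.
  by rewrite !le_max !lexx orbT.
rewrite prednK//.
move=> b; rewrite inE => /predU1P[->|bs] q.
  move=> /aP; apply: puiseux_suppW => //; last by case: hN.
  exact: dvdn_mull.
move=> /(IH _ bs); apply: puiseux_suppW => //; last by case: hN.
exact: dvdn_mulr.
Qed.

End PuiseuxOfFps.

Section PuiseuxZmod.
Variable F : zmodType.
Implicit Types a b c : puiseux F.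

Lemma puiseux_zero_supp : puiseux_supp (fun=> 0 : F).
Proof. by exists 1%N, 0; split=> // q; rewrite eqxx. Qed.
Definition puiseux_zero : puiseux F := Puiseux puiseux_zero_supp.

Lemma puiseux_opp_supp a : puiseux_supp (fun q => - a@_q).
Proof.
have [p [N [p0 aP]]] := pcoef_supp a; exists p, N; split=> // q.
by rewrite oppr_eq0; exact: aP.
Qed.
Definition puiseux_opp a := Puiseux (puiseux_opp_supp a).

Lemma puiseux_add_supp a b : puiseux_supp (fun q => a@_q + b@_q).
Proof.
have [p [N sP]] := puiseux_common [:: a; b].
have [A ->] := sP a (mem_head _ _).
have [|B ->] := sP b; first by rewrite !inE eqxx orbT.
exists p.+1, N; split=> // q q0.
suff [j ->] : exists j : nat, q = (N - j%:Z)%:~R / p.+1%:R.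
  by exists (N - j%:Z) => //; rewrite gerBl.
have [A0|/fps_puiseux_neq0//] := eqVneq ((fps_puiseux p N A)@_q) 0.
by move: q0; rewrite A0 add0r => /fps_puiseux_neq0.
Qed.
Definition puiseux_add a b := Puiseux (puiseux_add_supp a b).

Lemma puiseux_addA : associative puiseux_add.
Proof. by move=> a b c; apply: puiseuxP => q /=; rewrite addrA. Qed.
Lemma puiseux_addC : commutative puiseux_add.
Proof. by move=> a b; apply: puiseuxP => q /=; rewrite addrC. Qed.
Lemma puiseux_add0 : left_id puiseux_zero puiseux_add.
Proof. by move=> a; apply: puiseuxP => q /=; rewrite add0r. Qed.
Lemma puiseux_addN : left_inverse puiseux_zero puiseux_opp puiseux_add.
Proof. by move=> a; apply: puiseuxP => q /=; rewrite addNr. Qed.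

HB.instance Definition _ := GRing.isZmodule.Build (puiseux F)
  puiseux_addA puiseux_addC puiseux_add0 puiseux_addN.

Lemma pcoef0 q : (0 : puiseux F)@_q = 0. Proof. by []. Qed.
Lemma pcoefD a b q : (a + b)@_q = a@_q + b@_q. Proof. by []. Qed.
Lemma pcoefN a q : (- a)@_q = - a@_q. Proof. by []. Qed.
Lemma pcoef_sum I (r : seq I) (P : pred I) (f : I -> puiseux F) q :
  (\sum_(i <- r | P i) f i)@_q = \sum_(i <- r | P i) (f i)@_q.
Proof. by elim/big_ind2: _ => // a x b y <- <-. Qed.

Lemma fps_puiseuxD p N (A B : fps F) :
  fps_puiseux p N (A + B) = fps_puiseux p N A + fps_puiseux p N B.
Proof.
apply: puiseuxP => q; rewrite pcoefD /= /fps_puiseux_fun.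
by case: ifP; rewrite ?addr0.
Qed.
End PuiseuxZmod.

Section PuiseuxRing.
Variable F : fieldType.
Implicit Types a b c : puiseux F.

(* the sum has finite support, see puiseux_mul_fps *)
Definition puiseux_mul_fun a b (q : rat) : F :=
  \sum_(r \in [set: rat]) a@_r * b@_(q - r).

Lemma puiseux_mul_fps p N N' (A B : fps F) :
  puiseux_mul_fun (fps_puiseux p N A) (fps_puiseux p N' B) =1
  pcoef (fps_puiseux p (N + N') (A * B)).
Proof.
move=> q; rewrite /puiseux_mul_fun.
have p0 : (p.+1%:R : rat) != 0 by rewrite pnatr_eq0.
have [[n qn]|nj] := pselect (exists n : nat, q = (N + N' - n%:Z)%:~R / p.+1%:R);
  last first.
  rewrite fsbig1; last first.
    move=> r _; apply/eqP; apply: contrapT => /negP.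
    rewrite mulf_eq0 negb_or => /andP[/fps_puiseux_neq0[i ri]].
    move=> /fps_puiseux_neq0[j rj]; apply: nj; exists (i + j)%N.
    rewrite -[LHS](subrK r) rj ri -mulrDl -rmorphD/= PoszD.
    by congr (_%:~R / _); lia.
  by apply/esym/eqP; apply: contrapT => /negP /fps_puiseux_neq0.
rewrite qn fps_puiseuxE fps_coefM.
pose h (i : nat) : rat := (N - i%:Z)%:~R / p.+1%:R.
have h_inj : injective h.
  move=> i j /(mulIf (invr_neq0 p0))/eqP.
  by rewrite eqr_int (inj_eq (addrI _)) eqr_opp => /eqP[].
have subh i : (i <= n)%N ->
    (N + N' - n%:Z)%:~R / p.+1%:R - h i = (N' - (n - i)%:Z)%:~R / p.+1%:R.
  by move=> le_in; rewrite -mulrBl -rmorphB/=; congr (_%:~R / _); lia.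
rewrite (fsbigE (map h (iota 0 n.+1))) //; first last.
- move=> r _ rN; apply/eqP; apply: contrapT => /negP.
  rewrite mulf_eq0 negb_or => /andP[/fps_puiseux_neq0[i ri]].
  move=> /fps_puiseux_neq0[j rj]; move/negP: rN; apply.
  apply/mapP; exists i => //; rewrite mem_iota /= add0n ltnS.
  move/eqP: rj; rewrite ri -mulrBl -rmorphB/= (inj_eq (mulIf (invr_neq0 p0))).
  rewrite eqr_int => /eqP e; lia.
- by rewrite map_inj_uniq ?iota_uniq.
rewrite big_map -[iota 0 n.+1]/(index_iota 0 n.+1) big_mkord.
rewrite (eq_bigl xpredT); last by move=> i; apply/asboolP.
apply: eq_bigr => i _; rewrite subh ?leq_ord// fps_puiseuxE.
by rewrite /h fps_puiseuxE.
Qed.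

Lemma puiseux_mul_supp a b : puiseux_supp (puiseux_mul_fun a b).
Proof.
have [p [N sP]] := puiseux_common [:: a; b].
have [A ->] := sP a (mem_head _ _).
have [|B ->] := sP b; first by rewrite !inE eqxx orbT.
by rewrite (funext (puiseux_mul_fps p N N A B)); exact: pcoef_supp.
Qed.
Definition puiseux_mul a b := Puiseux (puiseux_mul_supp a b).

Lemma fps_puiseuxM p N N' (A B : fps F) :
  puiseux_mul (fps_puiseux p N A) (fps_puiseux p N' B) =
  fps_puiseux p (N + N') (A * B).
Proof. by apply: puiseuxP; exact: puiseux_mul_fps. Qed.

Lemma puiseux_common3 a b c : exists p N A B C, [/\ a = fps_puiseux p N A,
  b = fps_puiseux p N B & c = fps_puiseux p N C].
Proof.
have [p [N sP]] := puiseux_common [:: a; b; c].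
have [A aE] := sP a (mem_head _ _).
have [|B bE] := sP b; first by rewrite !inE eqxx orbT.
have [|C cE] := sP c; first by rewrite !inE eqxx !orbT.
by exists p, N, A, B, C.
Qed.

Lemma puiseux_mulA : associative puiseux_mul.
Proof.
move=> a b c; have [p [N [A [B [C [-> -> ->]]]]]] := puiseux_common3 a b c.
by rewrite !fps_puiseuxM mulrA addrA.
Qed.

Lemma puiseux_mulC : commutative puiseux_mul.
Proof.
move=> a b; have [p [N [A [B [_ [-> -> _]]]]]] := puiseux_common3 a b a.
by rewrite !fps_puiseuxM mulrC.
Qed.

Lemma puiseux_mulDl : left_distributive puiseux_mul +%R.
Proof.
move=> a b c; have [p [N [A [B [C [-> -> ->]]]]]] := puiseux_common3 a b c.
by rewrite -!fps_puiseuxD !fps_puiseuxM mulrDl fps_puiseuxD.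
Qed.

Lemma puiseux_mono_supp (c : F) (e : rat) :
  puiseux_supp (fun q => if q == e then c else 0).
Proof.
exists `|denq e|%N, (numq e); split; first by rewrite absz_gt0 denq_neq0.
move=> q; have [-> _|_] := eqVneq q e; last by rewrite eqxx.
exists (numq e) => //; rewrite -[LHS]divq_num_den; congr (_ / _).
by rewrite pmulrn gez0_abs// denq_ge0.
Qed.
(* c x^e *)
Definition puiseux_mono (c : F) (e : rat) : puiseux F := Puiseux (puiseux_mono_supp c e).

Lemma fps_puiseux1 p : fps_puiseux p 0 (1 : fps F) = puiseux_mono 1 0.
Proof.
apply: puiseuxP => q.
have [[j ->]|nj] := pselect (exists j : nat, q = (0 - j%:Z)%:~R / p.+1%:R).
  rewrite fps_puiseuxE /= mulf_eq0 invr_eq0 pnatr_eq0 orbF intr_eq0.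
  by rewrite sub0r oppr_eq0 eqz_nat.
have -> : (fps_puiseux p 0 (1 : fps F))@_q = 0.
  by apply/eqP; apply: contrapT => /negP /fps_puiseux_neq0.
rewrite /=; have [q0|_ //] := eqVneq q 0; case: nj; exists 0%N.
by rewrite q0 subr0 mul0r.
Qed.

Lemma puiseux_mul1 : left_id (puiseux_mono 1 0) puiseux_mul.
Proof.
move=> a; have [p [N [A [_ [_ [-> _ _]]]]]] := puiseux_common3 a a a.
by rewrite -(fps_puiseux1 p) fps_puiseuxM add0r mul1r.
Qed.

Lemma puiseux_oner_neq0 : puiseux_mono 1 0 != 0.
Proof.
by apply/eqP => /(congr1 (fun a => a@_0)) /eqP; rewrite /= oner_eq0.
Qed.

HB.instance Definition _ := GRing.Zmodule_isComNzRing.Build (puiseux F)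
  puiseux_mulA puiseux_mulC puiseux_mul1 puiseux_mulDl puiseux_oner_neq0.

Lemma pcoefM a b q : (a * b)@_q = \sum_(r \in [set: rat]) a@_r * b@_(q - r).
Proof. by []. Qed.

Lemma puiseux_has_inv a : a != 0 -> exists b, b * a = 1.
Proof.
move=> a0; have [p [N [A [_ [_ [aE _ _]]]]]] := puiseux_common3 a a a.
have exA : exists n, A``_n != 0.
  apply: contrapT => nA; move/negP: a0; apply; apply/eqP; rewrite aE.
  apply: puiseuxP => q; apply/eqP; apply: contrapT => /negP q0.
  have [j qj] := fps_puiseux_neq0 q0; apply: nA; exists j.
  by move: q0; rewrite qj fps_puiseuxE.
pose d := ex_minn exA; pose B := Fps (fun n => A``_(d + n)).
have aB : a = fps_puiseux p (N - d%:Z) B.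
  rewrite aE; apply: puiseuxP => q; rewrite /= /fps_puiseux_fun.
  case: (denq _ == 1) => //=; set k := numq _.
  have [kN|kN] := leP k N; last first.
    by rewrite ifF//; apply/negbTE; rewrite -ltNge; lia.
  case: leP => kd.
    by rewrite /B /=; congr (A``_ _); lia.
  apply/eqP; apply: contrapT => /negP; rewrite /d in kd *.
  by case: ex_minnP kd => m _ mmin kd /mmin; lia.
have uB : B \is a GRing.unit.
  rewrite unfold_in /= /fps_unit /= unitfE addn0 /d.
  by case: ex_minnP.
exists (fps_puiseux p (d%:Z - N) B^-1).
rewrite aB [LHS]fps_puiseuxM mulVr// (_ : _ + _ = 0) ?fps_puiseux1//.
by lia.
Qed.

Definition puiseux_inv a : puiseux F :=
  if pselect (a != 0) is left a0 then projT1 (cid (puiseux_has_inv a0)) else 0.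

Lemma puiseux_mulVf a : a != 0 -> puiseux_inv a * a = 1.
Proof. by rewrite /puiseux_inv; case: pselect => // h _; case: cid. Qed.

Lemma puiseux_inv0 : puiseux_inv 0 = 0.
Proof. by rewrite /puiseux_inv; case: pselect => // h; case/eqP: (h). Qed.

HB.instance Definition _ :=
  GRing.ComNzRing_isField.Build (puiseux F) puiseux_mulVf puiseux_inv0.

Lemma puiseux_scale_supp (c : F) a : puiseux_supp (fun q => c * a@_q).
Proof.
have [p [N [p0 aP]]] := pcoef_supp a; exists p, N; split=> // q.
by rewrite mulf_eq0 negb_or => /andP[_]; exact: aP.
Qed.
Definition puiseux_scale (c : F) a := Puiseux (puiseux_scale_supp c a).

Lemma puiseux_scalerA (c d : F) a :
  puiseux_scale c (puiseux_scale d a) = puiseux_scale (c * d) a.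
Proof. by apply: puiseuxP => q /=; rewrite mulrA. Qed.
Lemma puiseux_scale1r : left_id 1 puiseux_scale.
Proof. by move=> a; apply: puiseuxP => q /=; rewrite mul1r. Qed.
Lemma puiseux_scalerDr : right_distributive puiseux_scale +%R.
Proof. by move=> c a b; apply: puiseuxP => q /=; rewrite mulrDr. Qed.
Lemma puiseux_scalerDl a : {morph puiseux_scale^~ a : c d / c + d}.
Proof. by move=> c d; apply: puiseuxP => q /=; rewrite mulrDl. Qed.

HB.instance Definition _ := GRing.Zmodule_isLmodule.Build F (puiseux F)
  puiseux_scalerA puiseux_scale1r puiseux_scalerDr puiseux_scalerDl.

Lemma pcoefZ (c : F) a q : (c *: a)@_q = c * a@_q. Proof. by []. Qed.

Lemma puiseux_scalerAl (c : F) a b : c *: (a * b) = (c *: a) * b.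
Proof.
apply: puiseuxP => q; rewrite pcoefZ !pcoefM mulr_fsumr.
by apply: eq_fsbigr => r _; rewrite pcoefZ mulrA.
Qed.

HB.instance Definition _ :=
  GRing.Lmodule_isLalgebra.Build F (puiseux F) puiseux_scalerAl.
HB.instance Definition _ := GRing.Lalgebra_isComAlgebra.Build F (puiseux F).
End PuiseuxRing.

Section PuiseuxX.
Variable F : fieldType.

(* the indeterminate x *)
Definition pX : puiseux F := puiseux_mono 1 1.

Lemma puiseux_monoM (c d : F) (e f : rat) :
  puiseux_mono c e * puiseux_mono d f = puiseux_mono (c * d) (e + f).
Proof.
apply: puiseuxP => q; rewrite pcoefM (fsbigTE [fset e]%fset) => [|r]; last first.
  by rewrite inE /= => /negbTE ->; rewrite mul0r.
rewrite big_seq_fset1 /= eqxx subr_eq [f + e]addrC.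
by case: ifP; rewrite ?mulr0.
Qed.

Lemma pX_neq0 : pX != 0.
Proof.
by apply/eqP => /(congr1 (fun a => a@_1)) /eqP; rewrite /= oner_eq0.
Qed.

Lemma pX_exprz (k : int) : pX ^ k = puiseux_mono 1 k%:~R.
Proof.
have pXn n : pX ^+ n = puiseux_mono 1 n%:R.
  elim: n => [//|n IH]; rewrite exprS IH puiseux_monoM mul1r.
  by rewrite -[n.+1]add1n natrD.
case: k => n; first by rewrite -exprnP pXn -pmulrn.
rewrite NegzE -exprnN pXn; apply: (mulIf (x := puiseux_mono 1 n.+1%:R)).
  by rewrite -pXn expf_neq0 // pX_neq0.
rewrite puiseux_monoM mulVf; last by rewrite -pXn expf_neq0 // pX_neq0.
by rewrite mul1r mulrNz addNr.
Qed.

Lemma pcoefXz (k : int) (q : rat) : (pX ^ k)@_q = (q == k%:~R)%:R.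
Proof. by rewrite pX_exprz /=; case: eqVneq. Qed.

Definition no_pos_power (a : puiseux F) : Prop :=
  forall q : rat, 0 < q -> a@_q = 0.

Lemma nonneg_part_supp (a : puiseux F) :
  puiseux_supp (fun q => if 0 <= q then a@_q else 0).
Proof.
have [p [N [p0 aP]]] := pcoef_supp a; exists p, N; split=> // q.
by case: ifP => [_ /aP|]; last by rewrite eqxx.
Qed.
Definition nonneg_part (a : puiseux F) : puiseux F :=
  Puiseux (nonneg_part_supp a).

(* the operator [x^>=], applied to the coefficient of each t^n *)
Definition fps_nonneg_part (G : fps (puiseux F)) : fps (puiseux F) :=
  Fps (fun n => nonneg_part G``_n).

(* In a polynomial over {poly F}, the inner variable stands for x and the
   outer one for t. *)
Definition fps_of_poly2 (A : {poly {poly F}}) : fps (puiseux F) :=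
  fps_of_poly (map_poly (horner_alg pX) A).

Definition fps_rational (G : fps (puiseux F)) : Prop :=
  exists A B : {poly {poly F}}, B != 0 /\ fps_of_poly2 B * G = fps_of_poly2 A.
End PuiseuxX.

Section Walks.
Variables (F : fieldType) (S : {fset int}) (w : int -> F).

(* position after the first k steps, starting from 0 *)
Definition walk_pos n (s : n.-tuple S) (k : nat) : int :=
  \sum_(j < n | (j < k)%N) val (tnth s j).

Definition walk_in_N n (s : n.-tuple S) : bool :=
  [forall k : 'I_n.+1, 0 <= walk_pos s k].

Definition walk_weight n (s : n.-tuple S) : F :=
  \prod_(j < n) w (val (tnth s j)).

Definition walk_count (i n : nat) : F :=
  \sum_(s : n.-tuple S | walk_in_N s && (walk_pos s n == i%:Z)) walk_weight s.

(* each inner sum has finite support, see walk_gf_coef *)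
Definition walk_gf : fps (puiseux F) :=
  Fps (fun n => \sum_(i \in [set: nat]) walk_count i n *: pX F ^+ i).

Lemma walk_gf_coef (n : nat) (q : rat) : (walk_gf``_n)@_q =
  if (denq q == 1) && (0 <= q) then walk_count `|numq q|%N n else 0.
Proof.
pose E := [fset `|walk_pos s n|%N | s in [set: n.-tuple S]%SET]%fset.
have notE i : i \notin E -> walk_count i n = 0.
  move=> iE; rewrite /walk_count big1// => s /andP[_ /eqP si].
  case/negP: iE; apply/imfsetP; exists s; first by rewrite /= inE.
  by rewrite si.
rewrite /walk_gf /= (fsbigTE E) => [|i /notE ->]; last by rewrite scale0r.
rewrite pcoef_sum.
under eq_bigr do rewrite pcoefZ exprnP pcoefXz -pmulrn.
case: ifPn => [/andP[/eqP d1 q0]|nq].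
  set i0 := `|numq q|%N; have qi : q = i0%:R.
    rewrite -[LHS]divq_num_den d1 divr1 pmulrn gez0_abs//.
    by rewrite numq_ge0.
  rewrite qi; under eq_bigr do rewrite eqr_nat eq_sym mulr_natr mulrb.
  have [iE|iE] := boolP (i0 \in E).
    rewrite (bigD1_seq i0) ?fset_uniq//= eqxx big1 ?addr0// => i /negbTE.
    by rewrite eq_sym => ->.
  rewrite (notE _ iE) big1_seq// => i /andP[_ iE'].
  by case: eqP => // ii; move: iE; rewrite -ii iE'.
rewrite big1// => i _; case: eqP => [qi|]; last by rewrite mulr0.
by case/negP: nq; rewrite qi ler0n pmulrn denq_int eqxx.
Qed.
End Walks.

Section Kernel.
Variables (F : fieldType) (S : {fset int}) (w : int -> F).
Local Notation x := (pX F).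
Local Notation t := (fpsX (puiseux F)).

(* Only meaningful for X != 0, because of the convention 0^-1 = 0. *)
Definition step_poly (X : puiseux F) : puiseux F :=
  \sum_(i <- S) w i *: X ^ i.

Definition deriv_step_poly (X : puiseux F) : puiseux F :=
  \sum_(i <- S) (w i * i%:~R) *: X ^ (i - 1).

(* The constant term (in t) of the kernel is 1, so it is invertible in the
   ring of power series in t; dividing by it expands in t first. *)
Definition kernel : fps (puiseux F) := 1 - t * fpsC (step_poly x).

Lemma kernel_unit : kernel \is a GRing.unit.
Proof.
rewrite unfold_in /= /fps_unit /kernel fps_coefD /=.
by rewrite big_ord1 /= mul0r subr0 unitr1.
Qed.

Definition root_series (xs : seq (puiseux F)) : fps (puiseux F) :=
  fpsC (\prod_(X <- xs) (1 - x^-1 * X)) / kernel.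

Definition deriv_series : fps (puiseux F) :=
  fpsC (deriv_step_poly x) / (fpsC (w 1)%:A * kernel).
End Kernel.

(* Main.v *)
Require Import Defs.
From HB Require Import structures.
From mathcomp Require Import all_boot all_order all_algebra.
From mathcomp Require Import finmap boolp fsbigop separable zify.

Set Implicit Arguments.
Unset Strict Implicit.
Unset Printing Implicit Defensive.

Import Order.TTheory GRing.Theory Num.Theory.

Local Open Scope ring_scope.

(** The roots.  Look for X of the form x^(N/p) A(z), where z = x^(-1/p) and A
    is a power series with constant term u <> 0: take p = N = 1 for the M large
    roots, and p = m, N = - M for the m small ones.  After clearing
    denominators, S(X) = S(x) becomes a polynomial equation for A over F[[z]]
    whose reduction at z = 0 only sees the extreme steps: it reads u^M = 1 up
    to a factor u^m, respectively w_M u^m = w_(-m).  Both have as many distinct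
    nonzero solutions in F as their degree, and each is a simple root since F
    has characteristic zero, so Hensel's lemma [fps_hensel] lifts them.  This
    gives M + m series with distinct leading terms, hence all the roots of the
    polynomial X^m (S(X) - S(x)), of degree m + M in X.

    The walks.  Let q_n(u) be the polynomial that enumerates the n-step walks
    that stay in N by their endpoint.  Appending a step gives
      u^m q_(n+1)(u) = S(u) u^m q_n(u) - o_n(u),
    where o_n enumerates the walks whose last step leaves N; its degree is
    less than m.  Let D(u) be the product of the u - x_j, and let r_n be the
    remainder of u^m q_n(u) modulo D.  Since S(x_j) = S(x), evaluating the
    recurrence at the m distinct points x_j gives r_(n+1) = S(x) r_n - o_n.
    Hence x^m q_n(x) - r_n(x) is multiplied by S(x) when n increases by 1, and
    as it equals D(x) for n = 0,
      q_n(x) = x^(-m) D(x) S(x)^n + x^(-m) r_n(x).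
    The first term is the coefficient of t^n in the series of the proposition.
    The second one has only negative exponents: the coefficients of D, hence
    those of r_n, contain no positive power of x, and r_n has degree less than
    m.  See [walk_poly_sub_remainder] and [walk_gf_root_series].

    The case M = 1.  The only large root is x itself, so X^m (S(X) - S(x)) is
    w_1 (X - x) D(X); differentiating at X = x gives x^m S'(x) = w_1 D(x). *)

(** * Power series and Hensel's lemma *)

Section FpsBasics.
Variable R : comNzRingType.
Implicit Types a b : fps R.

Lemma fps_coefM_low a b n : (forall i, (i < n)%N -> a``_i = 0) ->
  (a * b)``_n = a``_n * b``_0.
Proof.
move=> a0; rewrite fps_coefM big_ord_recr /= subnn big1 ?add0r// => i _.
by rewrite a0 ?mul0r.
Qed.

Lemma fps_coefCM c a n : (fpsC c * a)``_n = c * a``_n.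
Proof.
rewrite fps_coefM big_ord_recl /= subn0 big1 ?addr0// => i _.
by rewrite mul0r.
Qed.

Lemma fps_coefXM a n : (fpsX R * a)``_n.+1 = a``_n.
Proof.
rewrite fps_coefM big_ord_recl big_ord_recl /= mul0r add0r mul1r subSS subn0.
by rewrite big1 ?addr0// => i _; rewrite mul0r.
Qed.

Lemma fps_coefXM0 a : (fpsX R * a)``_0 = 0.
Proof. by rewrite fps_coefM big_ord1 /= mul0r. Qed.

(** The reduction modulo the indeterminate. *)
Definition fps_const a := a``_0.
Arguments fps_const : simpl never.

Lemma fps_const_is_zmod_morphism : zmod_morphism fps_const.
Proof. by []. Qed.

Lemma fps_const_is_monoid_morphism : monoid_morphism fps_const.
Proof. by split=> // a b; rewrite /fps_const fps_coefM big_ord1. Qed.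

HB.instance Definition _ :=
  GRing.isZmodMorphism.Build (fps R) R fps_const fps_const_is_zmod_morphism.
HB.instance Definition _ :=
  GRing.isMonoidMorphism.Build (fps R) R fps_const fps_const_is_monoid_morphism.

Lemma fpsC_is_zmod_morphism : zmod_morphism (@fpsC R).
Proof. by move=> x y; apply: fpsP => -[|n] //=; rewrite subr0. Qed.

Lemma fpsC_is_monoid_morphism : monoid_morphism (@fpsC R).
Proof.
split=> // x y; apply: fpsP => n; rewrite fps_coefCM /=.
by case: eqP => // _; rewrite mulr0.
Qed.

HB.instance Definition _ :=
  GRing.isZmodMorphism.Build R (fps R) (@fpsC R) fpsC_is_zmod_morphism.
HB.instance Definition _ :=
  GRing.isMonoidMorphism.Build R (fps R) (@fpsC R) fpsC_is_monoid_morphism.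

End FpsBasics.

Section PolyDiff.
Variable R : comNzRingType.

Lemma horner_sub_dvd (p : {poly R}) (a b : R) :
  exists r, p.[a] - p.[b] = (a - b) * r.
Proof.
have /factor_theorem[q qE] : root (p - p.[b]%:P) b.
  by rewrite rootE hornerD hornerN hornerC subrr.
exists q.[a]; move/(congr1 (fun s => s.[a])): qE.
by rewrite !hornerE => ->; rewrite mulrC.
Qed.

Lemma horner_taylor1 (p : {poly R}) (a h : R) :
  exists r, p.[a + h] = p.[a] + h * (p^`().[a] + h * r).
Proof.
have /factor_theorem[q qE] : root (p - p.[a]%:P) a.
  by rewrite rootE hornerD hornerN hornerC subrr.
have [r rE] := horner_sub_dvd q (a + h) a.
exists r; have dp : p^`().[a] = q.[a].
  have -> : p = q * ('X - a%:P) + p.[a]%:P by rewrite -qE subrK.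
  by rewrite derivD derivC addr0 derivM derivXsubC !hornerE subrr mulr0 add0r.
move/(congr1 (fun s => s.[a + h])): qE; rewrite !hornerE addrAC subrr add0r.
move=> /eqP; rewrite subr_eq => /eqP ->; rewrite addrC; congr (_ + _).
rewrite dp mulrC; congr (_ * _).
by move/eqP: rE; rewrite subr_eq => /eqP ->; rewrite addrC addrAC subrr add0r.
Qed.
End PolyDiff.

Section Hensel.
Variables (F : fieldType) (p : {poly fps F}) (u : F).
Let p0 := map_poly (@fps_const F) p.
Hypotheses (p0u : root p0 u) (dp0u : p0^`().[u] != 0).

(** Corrects the coefficient of index [n > 0]: if [V] has constant term [u],
    then by the first order Taylor formula adding [c * z ^ n] to [V] changes
    that coefficient of [p.[V]] by [c * p0^`().[u]] and leaves the lower ones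
    alone. *)
Definition newton_step n (V : fps F) : fps F :=
  V + Fps (fun i => if i == n then - p.[V]``_n / p0^`().[u] else 0).

Fixpoint newton_seq n : fps F :=
  if n is n'.+1 then newton_step n (newton_seq n') else fpsC u.

Lemma newton_seq_const n : (newton_seq n)``_0 = u.
Proof. by elim: n => //= n ->; rewrite addr0. Qed.

Lemma newton_seq_stable n i : (i <= n)%N ->
  (newton_seq n)``_i = (newton_seq i)``_i.
Proof.
elim: n => [|n IH]; first by rewrite leqn0 => /eqP ->.
rewrite leq_eqVlt => /predU1P[-> //|]; rewrite ltnS => le_in.
by rewrite -IH//= ifF ?addr0//; apply/negbTE; rewrite neq_ltn ltnS le_in.
Qed.

Lemma newton_seq_root n i : (i <= n)%N -> p.[newton_seq n]``_i = 0.
Proof.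
have const V : V``_0 = u ->
    p.[V]``_0 = 0 /\ p^`().[V]``_0 = p0^`().[u].
  move=> V0; split.
    by rewrite -[LHS]/(fps_const _) -horner_map/= /fps_const V0; exact/rootP.
  by rewrite -[LHS]/(fps_const _) -horner_map/= -deriv_map /fps_const V0.
elim: n i => [|n IH] i.
  by rewrite leqn0 => /eqP ->; case: (const (fpsC u)).
move=> le_in; rewrite /= /newton_step; set V := newton_seq n.
set h := Fps _; have [r ->] := horner_taylor1 p V h.
have h0 j : (j < n.+1)%N -> h``_j = 0 by move=> jn; rewrite /= ltn_eqF.
rewrite fps_coefD fps_coefM_low => [|j ji]; last first.
  by apply: h0; exact: leq_trans ji le_in.
move: le_in; rewrite leq_eqVlt => /predU1P[->|le_in]; last first.
  by rewrite IH// h0// mul0r addr0.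
rewrite fps_coefD fps_coefM_low// [h``_0]h0// mul0r addr0.
rewrite (proj2 (const _ (newton_seq_const n))) /= eqxx.
by rewrite divfK// subrr.
Qed.

(** Hensel's lemma for power series over a field: a simple root of the reduced
    polynomial is the constant term of a root. *)
Lemma fps_hensel : exists2 U : fps F, U``_0 = u & root p U.
Proof.
(* [newton_step n] is the last one to change the coefficient of index n. *)
pose U := Fps (fun n => (newton_seq n)``_n).
exists U => //; apply/eqP/fpsP => n; rewrite fps_coef0.
have [r /eqP] := horner_sub_dvd p U (newton_seq n).
rewrite subr_eq => /eqP ->.
have d0 i : (i <= n)%N -> (U - newton_seq n)``_i = 0.
  by move=> le_in; rewrite [LHS]/= newton_seq_stable// subrr.
rewrite fps_coefD newton_seq_root// addr0 fps_coefM_low ?d0 ?mul0r// => i /ltnW.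
exact: d0.
Qed.
End Hensel.

(** * Substituting a root of 1/x into a power series *)

Section FpsToPuiseux.
Variables (F : fieldType) (p : nat).

(** A(x^(-1/(p+1))): as in [fps_puiseux], the denominator is [p.+1]. *)
Definition fps_subst (A : fps F) : puiseux F := fps_puiseux p 0 A.

Lemma fps_subst_is_zmod_morphism : zmod_morphism fps_subst.
Proof.
move=> A B; apply/eqP; rewrite eq_sym subr_eq -[X in _ == X]fps_puiseuxD.
by rewrite subrK.
Qed.

Lemma fps_subst_is_monoid_morphism : monoid_morphism fps_subst.
Proof.
split=> [|A B]; first exact: fps_puiseux1.
by rewrite /fps_subst -[RHS]/(puiseux_mul _ _) fps_puiseuxM addr0.
Qed.

HB.instance Definition _ := GRing.isZmodMorphism.Build (fps F) (puiseux F)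
  fps_subst fps_subst_is_zmod_morphism.
HB.instance Definition _ := GRing.isMonoidMorphism.Build (fps F) (puiseux F)
  fps_subst fps_subst_is_monoid_morphism.

Lemma fps_puiseux_monomial (N : int) (A : fps F) (c : F) (j : nat) :
  (forall i, A``_i = if i == j then c else 0) ->
  fps_puiseux p N A = puiseux_mono c ((N - j%:Z)%:~R / p.+1%:R).
Proof.
move=> AE; apply: puiseuxP => q.
have p0 : (p.+1%:R : rat) != 0 by rewrite pnatr_eq0.
have [[i ->]|nj] := pselect (exists i : nat, q = (N - i%:Z)%:~R / p.+1%:R).
  rewrite fps_puiseuxE AE /= (inj_eq (mulIf (invr_neq0 p0))) eqr_int.
  by rewrite (inj_eq (addrI _)) eqr_opp.
rewrite /= ifF; last by apply/negbTE/eqP => qE; apply: nj; exists j.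
by apply/eqP; apply: contrapT => /negP /fps_puiseux_neq0.
Qed.

Lemma fps_substC c : fps_subst (fpsC c) = c%:A.
Proof.
rewrite /fps_subst (@fps_puiseux_monomial _ _ c 0)//.
apply: puiseuxP => q; rewrite pcoefZ /= subr0 mul0r.
by case: eqP; rewrite ?mulr1 ?mulr0.
Qed.

Lemma fps_substX : fps_subst (fpsX F) = puiseux_mono 1 (- p.+1%:R^-1).
Proof.
rewrite /fps_subst (@fps_puiseux_monomial _ _ 1 1); last first.
  by move=> i /=; case: eqP.
by rewrite sub0r mulN1r.
Qed.

Lemma puiseux_mono_exprz (e : rat) (k : int) :
  (puiseux_mono 1 e : puiseux F) ^ k = puiseux_mono 1 (e * k%:~R).
Proof.
have monoXn n : (puiseux_mono 1 e : puiseux F) ^+ n = puiseux_mono 1 (e * n%:R).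
  elim: n => [|n IH]; first by rewrite mulr0.
  by rewrite exprS IH puiseux_monoM mul1r -[n.+1]add1n natrD mulrDr mulr1.
case: k => n; first by rewrite -exprnP monoXn -pmulrn.
have nz : (puiseux_mono 1 (e * n.+1%:R) : puiseux F) != 0.
  apply/eqP => /(congr1 (fun a => a@_(e * n.+1%:R))) /eqP.
  by rewrite /= eqxx oner_eq0.
rewrite NegzE -exprnN monoXn; apply: (mulIf nz).
by rewrite mulVf// puiseux_monoM mul1r mulrNz mulrN addNr.
Qed.

Lemma fps_puiseux_factor N (A : fps F) :
  fps_puiseux p N A = fps_subst (fpsX F) ^ (- N) * fps_subst A.
Proof.
transitivity (fps_puiseux p N 1 * fps_subst A).
  by rewrite -[A in LHS]mul1r -[N in LHS]addr0 -fps_puiseuxM.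
congr (_ * _); rewrite (@fps_puiseux_monomial _ _ 1 0); last first.
  by case.
rewrite fps_substX puiseux_mono_exprz subr0 mulrNz mulrNN.
by rewrite mulrC.
Qed.

Lemma pX_fps_subst : pX F = fps_subst (fpsX F) ^ (- p.+1%:Z).
Proof.
rewrite fps_substX puiseux_mono_exprz mulrNz mulrNN -pmulrn mulVf//.
by rewrite pnatr_eq0.
Qed.

Lemma fps_substX_neq0 : fps_subst (fpsX F) != 0.
Proof.
apply/eqP => sX0; have := pX_neq0 F; rewrite pX_fps_subst sX0.
by rewrite exp0rz oppr_eq0 eqxx.
Qed.

End FpsToPuiseux.

(** * Roots of the step equation *)

Lemma big_fset_pick (T : choiceType) (V : nmodType) (A : {fset T}) (k : T)
    (P : pred T) (f : T -> V) :
  k \in A -> {in A, P =1 pred1 k} ->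
  \sum_(i <- A) (if P i then f i else 0) = f k.
Proof.
move=> kA PE; rewrite (bigD1_seq k) ?fset_uniq//= PE//= eqxx big_seq_cond.
rewrite big1 ?addr0// => i /andP[iA ik].
by rewrite PE//= (negbTE ik).
Qed.

(** As [n] and [c] are nonzero in [F], [X ^ n - c] is coprime to its derivative,
    so it has as many roots as its degree. *)
Lemma nth_roots (F : closedFieldType) (charF0 : [pchar F] =i pred0)
    (n : nat) (c : F) : (0 < n)%N -> c != 0 ->
  exists us : n.-tuple F, uniq us /\ forall u, u \in us -> u ^+ n = c.
Proof.
move=> n0 c0; have [us] := closed_field_poly_normal ('X^n - c%:P).
have mon : 'X^n - c%:P \is monic by exact: monicXnsubC.
rewrite (monicP mon) scale1r => usE.
have sz : size us == n.
  by rewrite -eqSS -(size_prod_XsubC us id) -usE size_XnsubC.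
exists (Tuple sz); split=> /=; last first.
  move=> u; rewrite -root_prod_XsubC -usE rootE !hornerE.
  by rewrite subr_eq0 => /eqP.
rewrite -separable_prod_XsubC -usE unlock derivB derivXn derivC subr0.
rewrite -scaler_nat coprimepZr; last first.
  by rewrite ((pcharf0P F).1 charF0) ?gtn_eqF.
apply: coprimep_expr; rewrite coprimepX rootE !hornerE expr0n gtn_eqF//.
by rewrite sub0r oppr_eq0.
Qed.

Lemma exprz_mul_exprn (L : fieldType) (x : L) (i : int) (m : nat) :
  x != 0 -> - m%:Z <= i -> x ^ i * x ^+ m = x ^+ (absz (i + m%:Z)%R).
Proof.
move=> x0 mi; rewrite [x ^+ m]exprnP -expfzDr// exprnP gez0_abs//; lia.
Qed.

Section Roots.
Variables (F : fieldType) (S : {fset int}) (w : int -> F) (m : nat).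
Hypothesis m_min : forall i, i \in S -> - m%:Z <= i.
Local Notation x := (pX F).
Local Notation L := (puiseux F).

(** X^m (S(X) - S(x)): the factor X^m clears the negative powers of X. *)
Definition step_eq_poly : {poly L} :=
  \sum_(i <- S) (w i)%:A *: 'X^(absz (i + m%:Z)%R) - step_poly S w x *: 'X^m.

Lemma step_eq_polyE (X : L) : X != 0 ->
  step_eq_poly.[X] = X ^+ m * (step_poly S w X - step_poly S w x).
Proof.
move=> X0; rewrite /step_eq_poly !hornerE horner_sum mulrBr.
congr (_ - _); last by rewrite mulrC.
rewrite mulr_sumr [LHS]big_seq [RHS]big_seq; apply: eq_bigr => i iS.
rewrite !hornerE -exprz_mul_exprn ?m_min//.
by rewrite mulr_algl scalerAl mulrC.
Qed.

(** Newton polygon argument along one edge: with z = x^(-1/(p+1)), the series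
    X = x^(N/(p+1)) A(z), for A nonzero, satisfies S(X) = S(x) if and only if A
    is a root of the polynomial z^E U^m (S(z^(-N) U) - S(x)) in U, whose
    coefficients are power series in z as soon as E bounds N i and (p+1) i for
    all steps i.  Its reduction at z = 0 is g, which keeps the steps where the
    bound is attained, and simple nonzero roots of g lift by Hensel's lemma. *)
Lemma puiseux_root_lift (p E : nat) (N : int) (u : F)
    (g := \sum_(i <- S)
            (if E%:Z - N * i == 0 then w i *: 'X^(absz (i + m%:Z)%R) else 0)
        - (\sum_(i <- S) (if E%:Z - p.+1%:Z * i == 0 then w i else 0))
            *: 'X^m) :
  (forall i, i \in S -> N * i <= E%:Z) ->
  (forall i, i \in S -> p.+1%:Z * i <= E%:Z) ->
  u != 0 -> root g u -> g^`().[u] != 0 ->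
  exists2 A : fps F, A``_0 = u &
    step_poly S w (fps_puiseux p N A) = step_poly S w x.
Proof.
move=> NE pE u0 gu dgu.
pose t := fpsX F.
pose G : {poly fps F} :=
  \sum_(i <- S)
    (fpsC (w i) * t ^+ (absz (E%:Z - N * i)%R)) *: 'X^(absz (i + m%:Z)%R)
  - (\sum_(i <- S) fpsC (w i) * t ^+ (absz (E%:Z - p.+1%:Z * i)%R)) *: 'X^m.
have const_wt i k : fps_const (fpsC (w i) * t ^+ (absz k)) =
    if k == 0 then w i else 0.
  rewrite rmorphM rmorphXn /= /fps_const /=.
  by rewrite expr0n absz_eq0; case: eqP; rewrite ?mulr1 ?mulr0.
have GE : map_poly (@fps_const F) G = g.
  rewrite /G rmorphB/= rmorph_sum/= map_polyZ/= map_polyXn rmorph_sum/=.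
  congr (_ - _ *: _); last by apply: eq_bigr => i _; exact: const_wt.
  apply: eq_bigr => i _; rewrite map_polyZ/= map_polyXn.
  rewrite [X in X *: _](const_wt i (E%:Z - N * i)).
  by case: eqP => // _; rewrite scale0r.
have [|| A A0 AG] := @fps_hensel F G u; rewrite ?GE//.
exists A => //; rewrite fps_puiseux_factor.
set z := fps_subst p (fpsX F); set a := fps_subst p A.
have z0 : z != 0 by exact: fps_substX_neq0.
have a0 : a != 0.
  apply: contraNneq u0 => a0; rewrite -A0 -(fps_puiseuxE p 0 A 0) subr0 mul0r.
  by rewrite -[fps_puiseux p 0 A]/a a0.
have zaE : z ^+ E * a ^+ m != 0 by rewrite mulf_neq0// expf_neq0.
(* Multiplying by z ^+ E * a ^+ m turns the step equation into G.[A] = 0. *)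
apply: (mulfI zaE); apply/eqP; rewrite -subr_eq0; apply/eqP.
move/rootP/(congr1 (fps_subst p)): AG; rewrite rmorph0 => <-.
rewrite /G !hornerE horner_sum rmorphB/= rmorph_sum/= rmorphM/= rmorph_sum/=.
have zsplit k : k <= E%:Z -> z ^+ E * z ^ (- k) = z ^+ (absz (E%:Z - k)%R).
  by move=> kE; rewrite mulrC exprz_mul_exprn// 1?addrC//; lia.
rewrite rmorphXn/= -/a /step_poly; congr (_ - _); last first.
  rewrite mulrAC; congr (_ * _); rewrite mulr_sumr [LHS]big_seq [RHS]big_seq.
  apply: eq_bigr => i iS; rewrite rmorphM rmorphXn/= fps_substC -zsplit ?pE//.
  by rewrite mulr_algl scalerAr; congr (_ * (_ *: _));
     rewrite (pX_fps_subst F p) -mulNr -exprz_exp.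
rewrite mulr_sumr [LHS]big_seq [RHS]big_seq.
apply: eq_bigr => i iS; rewrite !hornerE !(rmorphM, rmorphXn)/= fps_substC.
rewrite -/a -/z -zsplit ?NE// -exprz_mul_exprn ?m_min// expfzMl.
rewrite -mulNr -exprz_exp -!mulrA mulr_algl -!scalerAr.
by congr (_ *: (_ * _)); rewrite mulrCA [a ^+ m * _]mulrC.
Qed.

End Roots.

(** Series with distinct leading coefficients are distinct, so lifting distinct
    [u] produces a duplicate-free tuple. *)
Lemma distinct_lifts (F : fieldType) (P : puiseux F -> Prop) (p : nat) (N : int)
    (n : nat) (us : n.-tuple F) : uniq us ->
  (forall u, u \in us ->
     exists2 A : fps F, A``_0 = u & P (fps_puiseux p N A)) ->
  exists2 xs : n.-tuple (puiseux F), uniq xs &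
    forall X, X \in xs ->
      exists A : fps F, [/\ A``_0 \in us, X = fps_puiseux p N A & P X].
Proof.
move=> us_uniq lift.
have [|f fP] := @boolp.choice _ _ (fun u (A : fps F) => u \in us ->
    A``_0 = u /\ P (fps_puiseux p N A)).
  move=> u; have [uus|nu] := boolP (u \in us); last by exists 0.
  by have [A A0 PA] := lift u uus; exists A.
exists (map_tuple (fun u => fps_puiseux p N (f u)) us) => /=.
  rewrite map_inj_in_uniq// => u v uus vus.
  move=> /(congr1 (fun a => a@_((N - 0%:Z)%:~R / p.+1%:R))).
  by rewrite !fps_puiseuxE (fP u uus).1 (fP v vus).1.
move=> X /mapP[u uus ->]; exists (f u).
by have [-> ?] := fP u uus.
Qed.

Lemma mulrn_exprp (R : pzRingType) (u : R) (n : nat) :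
  (u ^+ n.-1 *+ n) * u = u ^+ n *+ n.
Proof. by case: n => [|n]; rewrite ?mul0r// mulrnAl -exprSr. Qed.

Section RootsOfStepEquation.
Variables (F : closedFieldType) (charF0 : [pchar F] =i pred0).
Variables (S : {fset int}) (w : int -> F) (m M : nat).
Hypotheses (w_neq0 : forall i, i \in S -> w i != 0).
Hypotheses (m_in : - m%:Z \in S) (m_min : forall i, i \in S -> - m%:Z <= i).
Hypotheses (M_in : M%:Z \in S) (M_max : forall i, i \in S -> i <= M%:Z).
Hypothesis M_gt0 : (0 < M)%N.
Local Notation x := (pX F).

Let natF_neq0 n : (0 < n)%N -> n%:R != 0 :> F.
Proof. by move=> n0; rewrite ((pcharf0P F).1 charF0) gtn_eqF. Qed.

(** Roots that behave like u x with u^M = 1: only the step M contributes to the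
    leading terms. *)
Lemma large_roots : exists2 ys : M.-tuple (puiseux F), uniq ys &
  forall Y, Y \in ys ->
    [/\ Y != 0, step_poly S w Y = step_poly S w x & Y@_1 != 0].
Proof.
have [us [us_uniq usP]] := nth_roots charF0 M_gt0 (oner_neq0 F).
have us0 u : u \in us -> u != 0.
  move=> /usP uM; apply/eqP => u0; move: uM; rewrite u0 expr0n gtn_eqF//.
  by move/eqP; rewrite eq_sym oner_eq0.
have isM : {in S, (fun i => M%:Z - i == 0) =1 pred1 M%:Z}.
  by move=> i _; rewrite subr_eq0 eq_sym.
have [|ys ys_uniq ysP] := @distinct_lifts F
    (fun X => step_poly S w X = step_poly S w x) 0 1 M us us_uniq.
  move=> u uus; apply: (puiseux_root_lift m_min (E := M)).
  - by move=> i /M_max; rewrite mul1r.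
  - by move=> i /M_max; rewrite mul1r.
  - exact: us0.
  - under eq_bigr do rewrite mul1r.
    under [X in _ - X *: _]eq_bigr do rewrite mul1r.
    rewrite !(big_fset_pick _ M_in isM) rootE !hornerE -PoszD absz_nat.
    by rewrite exprD usP// mul1r subrr.
  - under eq_bigr do rewrite mul1r.
    under [X in _ - X *: _]eq_bigr do rewrite mul1r.
    rewrite !(big_fset_pick _ M_in isM) -PoszD absz_nat.
    rewrite derivB !derivZ !derivXn !hornerE -mulrBr mulf_neq0 ?w_neq0//.
    (* Times u, the derivative is w_M (u^(M+m) (M+m) - u^m m) = w_M M u^m. *)
    apply: contra_neq (mulf_neq0 (natF_neq0 M_gt0) (expf_neq0 m (us0 _ uus))).
    move=> d0; have := mul0r u; rewrite -{1}d0 mulrBl.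
    rewrite !hornerMn !hornerXn !mulrn_exprp.
    by rewrite exprD usP// mul1r mulrnDr addrK mulr_natl.
exists ys => [//|Y /ysP[A [A0 YE eqA]]].
have Y1 : Y@_1 != 0.
  have -> : Y@_1 = A``_0; last exact: us0.
  by rewrite -(fps_puiseuxE 0 1 A 0) -YE; congr (pcoef Y _).
by split=> [||//]; [apply: contraNneq Y1 => ->|exact: eqA].
Qed.

(** Roots that behave like u x^(-M/m): the leading terms of S(X) and S(x) come
    from the steps -m and M and balance if w_(-m) u^(-m) = w_M. *)
Lemma small_roots : exists2 xs : m.-tuple (puiseux F), uniq xs &
  forall X, X \in xs ->
    [/\ X != 0, step_poly S w X = step_poly S w x &
        forall q, 0 <= q -> X@_q = 0].
Proof.
have [->|m_gt0] := posnP m; first by exists [tuple].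
have [p mE] : exists p, m = p.+1 by exists m.-1; rewrite prednK.
pose c := w (- m%:Z) / w M%:Z.
have c0 : c != 0 by rewrite mulf_neq0 ?invr_eq0 ?w_neq0.
have [us [us_uniq usP]] := nth_roots charF0 m_gt0 c0.
have us0 u : u \in us -> u != 0.
  move=> /usP um; apply: contraNneq c0 => u0; rewrite -um u0 expr0n gtn_eqF//.
have ism : {in S, (fun i => (m * M)%N%:Z - - M%:Z * i == 0) =1 pred1 (- m%:Z)}.
  move=> i iS /=; rewrite mulNr opprK PoszM mulrC -mulrDr.
  by rewrite mulf_eq0 eqz_nat gtn_eqF//= addrC addr_eq0.
have isM : {in S, (fun i => (m * M)%N%:Z - p.+1%:Z * i == 0) =1 pred1 M%:Z}.
  move=> i iS /=; rewrite -mE PoszM -mulrBr mulf_eq0 eqz_nat gtn_eqF//=.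
  by rewrite subr_eq0 eq_sym.
have [|xs xs_uniq xsP] := @distinct_lifts F
    (fun X => step_poly S w X = step_poly S w x) p (- M%:Z) m us us_uniq.
  move=> u uus; apply: (puiseux_root_lift m_min (E := (m * M)%N)).
  - by move=> i /m_min mi; rewrite PoszM; nia.
  - by move=> i /M_max iM; rewrite PoszM -mE; nia.
  - exact: us0.
  - rewrite (big_fset_pick _ m_in ism) (big_fset_pick _ M_in isM).
    rewrite addNr absz0 rootE !hornerE usP// /c mulrC divfK ?subrr//.
    exact: w_neq0.
  - rewrite (big_fset_pick _ m_in ism) (big_fset_pick _ M_in isM).
    rewrite addNr absz0 expr0 derivB !derivZ derivXn derivC scaler0 sub0r.
    rewrite !hornerE hornerMn hornerXn oppr_eq0 -mulr_natl.
    by rewrite !mulf_neq0 ?w_neq0 ?natF_neq0 ?expf_neq0 ?us0.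
exists xs => [//|X /xsP[A [A0 XE eqA]]].
have Xlead : X@_((- M%:Z - 0%:Z)%:~R / p.+1%:R) != 0.
  rewrite XE fps_puiseuxE; exact: us0.
split=> [|//|]; first by apply: contraNneq Xlead => ->.
move=> q q0; apply/eqP; apply: contrapT; rewrite XE.
move=> /negP /fps_puiseux_neq0[j qE].
have p0 : 0 < (p.+1%:R^-1 : rat) by rewrite invr_gt0 ltr0n.
move: q0; rewrite qE (pmulr_lge0 _ p0) ler0z.
have -> : - M%:Z - j%:Z = - (M + j)%N%:Z by rewrite PoszD opprD.
by rewrite oppr_ge0 lez_nat leqn0 addn_eq0 gtn_eqF.
Qed.

Lemma size_lead_coef_step_eq_poly :
  size (step_eq_poly S w m) = (m + M).+1 /\
  lead_coef (step_eq_poly S w m) = (w M%:Z)%:A.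
Proof.
pose c : puiseux F := (w M%:Z)%:A.
have c0 : c != 0 by rewrite scaler_eq0 oner_eq0 orbF w_neq0.
have coefE k : (m < k)%N -> (step_eq_poly S w m)`_k =
    \sum_(i <- S) if i == k%:Z - m%:Z then (w i)%:A else 0.
  move=> mk; rewrite coefB coef_sum coefZ coefXn gtn_eqF// mulr0 subr0.
  rewrite [LHS]big_seq [RHS]big_seq; apply: eq_bigr => i /m_min mi.
  rewrite coefZ coefXn.
  have -> : (k == absz (i + m%:Z)%R) = (i == k%:Z - m%:Z) by lia.
  by case: eqP; rewrite ?mulr1 ?mulr0.
have lc : (step_eq_poly S w m)`_(m + M) = c.
  rewrite coefE; last by rewrite -[X in (X < _)%N]addn0 ltn_add2l.
  rewrite (big_fset_pick _ M_in)// => i _ /=; congr (_ == _).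
  by rewrite PoszD addrC addKr.
have sz : size (step_eq_poly S w m) = (m + M).+1.
  apply/anti_leq/andP; split; last first.
    by rewrite ltnNge; apply: contraNN c0 => h; rewrite -lc nth_default.
  apply/leq_sizeP => k mk; rewrite coefE; last by lia.
  rewrite big1_seq// => i /andP[_ /M_max iM]; case: eqP => //; lia.
by rewrite lead_coefE sz.
Qed.

(** The small and the large roots are told apart by their exponents, and there
    are as many of them as the degree of [step_eq_poly]. *)
Lemma step_equation_roots :
  exists (xs : m.-tuple (puiseux F)) (ys : M.-tuple (puiseux F)),
    [/\ uniq (xs ++ ys),
        forall X,
          X \in xs ++ ys <-> X != 0 /\ step_poly S w X = step_poly S w x,
        forall X, X \in xs -> forall q, 0 <= q -> X@_q = 0,
        forall Y, Y \in ys -> Y@_1 != 0 &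
        step_eq_poly S w m = (w M%:Z)%:A *: \prod_(X <- xs ++ ys) ('X - X%:P)].
Proof.
have [xs xs_uniq xsP] := small_roots; have [ys ys_uniq ysP] := large_roots.
exists xs, ys.
have xys_uniq : uniq (xs ++ ys).
  rewrite cat_uniq xs_uniq ys_uniq andbT /=.
  apply/hasPn => Y /ysP[_ _ Y1]; apply: contraNN Y1 => /xsP[_ _ ->//].
have xysP X : X \in xs ++ ys -> X != 0 /\ step_poly S w X = step_poly S w x.
  rewrite mem_cat => /orP[/xsP[X0 eqX _]|/ysP[X0 eqX _]].
    exact: (conj X0 eqX).
  exact: (conj X0 eqX).
have [sz lc] := size_lead_coef_step_eq_poly.
have prodE : step_eq_poly S w m =
    (w M%:Z)%:A *: \prod_(X <- xs ++ ys) ('X - X%:P).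
  rewrite -lc; apply: all_roots_prod_XsubC.
  - by rewrite sz size_cat !size_tuple.
  - apply/allP => X /xysP[X0 eqX].
    by rewrite rootE (step_eq_polyE w m_min X0) eqX subrr mulr0.
  - by rewrite uniq_rootsE.
split=> [//|X|X /xsP[]//|Y /ysP[]//|//].
- split=> [/xysP//|[X0 eqX]]; rewrite -root_prod_XsubC.
  have : root (step_eq_poly S w m) X.
    by rewrite rootE (step_eq_polyE w m_min X0) eqX subrr mulr0.
  have c0 : (w M%:Z)%:A != 0 :> puiseux F.
    by rewrite scaler_eq0 oner_eq0 orbF; exact: w_neq0.
  by rewrite prodE (rootZ _ _ c0).
Qed.

End RootsOfStepEquation.

(** * Remainders without positive powers of x *)

(** Dividing by a monic polynomial needs no division of coefficients, so the
    remainder keeps its coefficients in any subring that contains those of the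
    two polynomials. *)
Lemma polyOver_divp_monic (R : nzRingType) (A : subringClosed R)
    (D p : {poly R}) :
  D \is monic -> D \is a polyOver A -> p \is a polyOver A ->
  exists q r, [/\ p = q * D + r, (size r < size D)%N & r \is a polyOver A].
Proof.
move=> Dmon DA; have D0 := monic_neq0 Dmon.
elim/poly_ind: p => [|p c IH] pA.
  by exists 0, 0; rewrite mul0r addr0 size_poly0 size_poly_gt0 rpred0.
have [|q [r [pE szr rA]]] := IH.
  apply/polyOverP => i; move/polyOverP: pA => /(_ i.+1).
  by rewrite coefD coefMX coefC addr0.
have cA : c \in A.
  by move/polyOverP: pA => /(_ 0%N); rewrite coefD coefMX coefC add0r.
(* r1 has size at most that of D; subtracting l D cancels its top term. *)
pose r1 := r * 'X + c%:P; pose l := r1`_(size D).-1.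
have r1A : r1 \is a polyOver A.
  by rewrite rpredD ?polyOverC// rpredM// polyOverX.
have lA : l \in A by exact: (polyOverP r1A).
exists (q * 'X + l%:P), (r1 - l *: D); split.
- rewrite pE mulrDl -mulrA (commr_polyX D) mulrA -addrA -/r1 mulrDl.
  by rewrite -mul_polyC -[RHS]addrA [l%:P * D + _]addrC subrK.
- rewrite -[X in (_ < X)%N]prednK ?size_poly_gt0// ltnS.
  apply/leq_sizeP => j; rewrite leq_eqVlt => /predU1P[<-|ltj].
    rewrite coefB coefZ -/l -lead_coefE (monicP Dmon) mulr1 subrr//.
  have szj : (size D <= j)%N by move: ltj; case: (size D).
  rewrite coefB coefZ [D`_j]nth_default// mulr0 subr0 /r1 coefD coefMX coefC.
  case: j ltj szj => // j _ szj; rewrite addr0 nth_default// -ltnS.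
  exact: leq_trans szr szj.
- by rewrite rpredB// polyOverZ.
Qed.

Section NoPosPower.
Variable F : fieldType.

(** [no_pos_power] as a boolean predicate, to carry the subring structure. *)
Definition no_pos : {pred puiseux F} := [pred a | `[< no_pos_power a >]].

Lemma no_posP (a : puiseux F) : reflect (no_pos_power a) (a \in no_pos).
Proof. exact: asboolP. Qed.

Lemma no_pos_subring : subring_closed no_pos.
Proof.
split.
- apply/no_posP => q q0; rewrite -[1]/(puiseux_mono 1 0) /=.
  by rewrite gt_eqF.
- move=> a b /no_posP a0 /no_posP b0; apply/no_posP => q q0.
  by rewrite pcoefD pcoefN a0// b0// subr0.
- move=> a b /no_posP a0 /no_posP b0; apply/no_posP => q q0.
  rewrite pcoefM fsbig1// => r _; have [r0|r0] := ltP 0 r.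
    by rewrite a0// mul0r.
  by rewrite b0 ?mulr0// subr_gt0 (le_lt_trans r0).
Qed.

HB.instance Definition _ :=
  GRing.isSubringClosed.Build (puiseux F) no_pos no_pos_subring.

Lemma no_posC (c : F) : c%:A \in no_pos.
Proof.
apply/no_posP => q q0; rewrite pcoefZ -[1]/(puiseux_mono 1 0) /=.
by rewrite gt_eqF ?mulr0.
Qed.

Lemma pcoef_monoM (e q : rat) (a : puiseux F) :
  (puiseux_mono 1 e * a)@_q = a@_(q - e).
Proof.
rewrite pcoefM (fsbigTE [fset e]%fset) => [|r]; last first.
  by rewrite inE /= => /negbTE ->; rewrite mul0r.
by rewrite big_seq_fset1 /= eqxx mul1r.
Qed.

(** The exponents of x^(-m) r(x) are at most the degree of r minus m, which is
    negative. *)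
Lemma horner_pX_low (m : nat) (r : {poly puiseux F}) (q : rat) :
  (size r <= m)%N -> r \is a polyOver no_pos -> 0 <= q ->
  (pX F ^- m * r.[pX F])@_q = 0.
Proof.
move=> szr rA q0; rewrite (horner_coef_wide _ szr) mulr_sumr pcoef_sum.
rewrite big1// => k _; rewrite mulrCA.
have -> : pX F ^- m * pX F ^+ k = puiseux_mono 1 (k%:Z - m%:Z)%:~R.
  by rewrite -pX_exprz addrC expfzDr ?pX_neq0// exprnN exprnP.
rewrite mulrC pcoef_monoM; have /polyOverP/(_ k)/no_posP := rA; apply.
rewrite subr_gt0; apply: lt_le_trans q0.
by rewrite ltrz0 subr_lt0 ltz_nat.
Qed.
End NoPosPower.

(** * The polynomials of walks *)

Section WalkPolynomials.
Variables (F : fieldType) (S : {fset int}) (w : int -> F) (m : nat).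
Hypothesis m_min : forall i, i \in S -> - m%:Z <= i.
Local Notation x := (pX F).

Definition walk_rcons n (p : n.-tuple S * S) : n.+1.-tuple S :=
  [tuple of rcons p.1 p.2].

Lemma walk_rcons_bij n : bijective (@walk_rcons n).
Proof.
apply: inj_card_bij => [[s a] [t b] /(congr1 val) /rcons_inj [st ->]|].
  by congr (_, _); exact: val_inj.
by rewrite card_prod !card_tuple expnSr.
Qed.

Lemma tnth_walk_rcons n (s : n.-tuple S) a (j : 'I_n) :
  tnth (walk_rcons (s, a)) (widen_ord (leqnSn n) j) = tnth s j.
Proof.
by rewrite !(tnth_nth a) /= nth_rcons size_tuple ltn_ord.
Qed.

Lemma tnth_walk_rcons_last n (s : n.-tuple S) a :
  tnth (walk_rcons (s, a)) ord_max = a.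
Proof.
by rewrite (tnth_nth a) /= nth_rcons size_tuple ltnn eqxx.
Qed.

Lemma walk_pos_rcons n (s : n.-tuple S) a k : (k <= n)%N ->
  walk_pos (walk_rcons (s, a)) k = walk_pos s k.
Proof.
move=> kn; rewrite /walk_pos big_mkcond big_ord_recr /= ltnNge kn /= addr0.
by rewrite -big_mkcond; apply: eq_bigr => j _; rewrite tnth_walk_rcons.
Qed.

Lemma walk_pos_rcons_last n (s : n.-tuple S) a :
  walk_pos (walk_rcons (s, a)) n.+1 = walk_pos s n + val a.
Proof.
rewrite /walk_pos big_mkcond big_ord_recr /= ltnSn tnth_walk_rcons_last.
congr (_ + _); rewrite [RHS]big_mkcond; apply: eq_bigr => j _.
by rewrite tnth_walk_rcons /= ltnS ltn_ord ltnW.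
Qed.

Lemma walk_in_N_rcons n (s : n.-tuple S) a :
  walk_in_N (walk_rcons (s, a)) = walk_in_N s && (0 <= walk_pos s n + val a).
Proof.
apply/forallP/andP => [h|[/forallP h ha] k].
- split; last by rewrite -walk_pos_rcons_last; exact: (h ord_max).
  apply/forallP => k; rewrite -(walk_pos_rcons s a) -1?ltnS//.
  exact: (h (widen_ord (leqnSn _) k)).
- have [kn|nk] := leqP k n.
    by rewrite walk_pos_rcons//; exact: (h (Ordinal (kn : (k < n.+1)%N))).
  have -> : nat_of_ord k = n.+1 by apply/eqP; rewrite eqn_leq nk leq_ord.
  by rewrite walk_pos_rcons_last.
Qed.

Lemma walk_weight_rcons n (s : n.-tuple S) a :
  walk_weight w (walk_rcons (s, a)) = walk_weight w s * w (val a).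
Proof.
rewrite /walk_weight big_ord_recr /= tnth_walk_rcons_last; congr (_ * _).
by apply: eq_bigr => j _; rewrite tnth_walk_rcons.
Qed.

Definition walk_poly n : {poly puiseux F} :=
  \sum_(s : n.-tuple S | walk_in_N s)
    (walk_weight w s)%:A *: 'X^(absz (walk_pos s n)).

(** u^m times the enumerator of the walks that stay in N for n steps and leave
    it at the next one.  They end between -m and -1, so that the exponents lie
    between 0 and m - 1. *)
Definition overshoot_poly n : {poly puiseux F} :=
  \sum_(p : n.-tuple S * S | walk_in_N p.1 && (walk_pos p.1 n + val p.2 < 0))
    (walk_weight w p.1 * w (val p.2))%:A
      *: 'X^(absz (walk_pos p.1 n + val p.2 + m%:Z)%R).

Lemma walk_poly0 : walk_poly 0 = 1.
Proof.
rewrite /walk_poly (bigD1 [tuple]) /=; last first.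
  by apply/forallP => k; rewrite /walk_pos big_ord0.
rewrite big1 => [|s /andP[_ /eqP[]]]; last exact: tuple0.
by rewrite /walk_pos /walk_weight !big_ord0 addr0 expr0 !scale1r.
Qed.

Lemma walk_pos_ge0 n (s : n.-tuple S) : walk_in_N s -> 0 <= walk_pos s n.
Proof. by move/forallP => /(_ ord_max). Qed.

(** The n-step walks extended by an arbitrary step split into those that stay
    in [N] and those that have just left it. *)
Lemma walk_polyS n (X : puiseux F) : X != 0 ->
  X ^+ m * (walk_poly n.+1).[X] =
  step_poly S w X * (X ^+ m * (walk_poly n).[X]) - (overshoot_poly n).[X].
Proof.
move=> X0; pose f (p : n.-tuple S * S) : puiseux F :=
  (walk_weight w p.1 * w (val p.2))%:A
    * X ^+ (absz (walk_pos p.1 n + val p.2 + m%:Z)%R).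
have term_split (a b : F) (k l : int) : - m%:Z <= l -> 0 <= k ->
    (a * b)%:A * X ^+ absz (k + l + m%:Z)%R =
    b *: X ^ l * (X ^+ m * (a%:A * X ^+ absz k)) :> puiseux F.
  move=> ml k0; have -> : X ^+ absz k = X ^ k by rewrite exprnP gez0_abs.
  rewrite -(exprz_mul_exprn X0 (_ : - m%:Z <= k + l)); last by lia.
  rewrite expfzDr// !mulr_algl -!scalerAl -!scalerAr scalerA [b * a]mulrC.
  by congr (_ *: _); rewrite [X ^ k * _]mulrC -mulrA [X ^ k * _]mulrC.
have totalE : step_poly S w X * (X ^+ m * (walk_poly n).[X]) =
    \sum_(p : n.-tuple S * S | walk_in_N p.1) f p.
  rewrite [RHS](eq_bigl (fun p => walk_in_N p.1 && xpredT p.2)); last first.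
    by move=> p; rewrite andbT.
  rewrite -(pair_big (fun s => walk_in_N s) xpredT (fun s a => f (s, a))) /=.
  rewrite /step_poly big_seq_fsetE /walk_poly horner_sum !mulr_sumr.
  apply: eq_bigr => s /walk_pos_ge0 s0; rewrite mulr_suml.
  apply: eq_bigr => a _; rewrite !hornerE /f /= term_split//.
    by rewrite !mulrA.
  exact/m_min/fsvalP.
have nextE : X ^+ m * (walk_poly n.+1).[X] = \sum_(p : n.-tuple S * S |
    walk_in_N p.1 && ~~ (walk_pos p.1 n + val p.2 < 0)) f p.
  rewrite /walk_poly horner_sum mulr_sumr.
  rewrite (reindex (@walk_rcons n)) /=; last exact/onW_bij/walk_rcons_bij.
  apply: eq_big => [[s a]|[s a]] /=; first by rewrite walk_in_N_rcons -leNgt.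
  rewrite walk_in_N_rcons walk_pos_rcons_last walk_weight_rcons => /andP[_ sa0].
  rewrite !hornerE /f /=.
  rewrite -(exprz_mul_exprn X0 (_ : - m%:Z <= walk_pos s n + fsval a));
    last first.
    by rewrite (le_trans _ sa0)// oppr_le0.
  rewrite [X ^+ m * _]mulrC -mulrA [X ^+ m * _]mulrC.
  by rewrite [X ^+ absz _]exprnP gez0_abs.
have overE : (overshoot_poly n).[X] = \sum_(p : n.-tuple S * S |
    walk_in_N p.1 && (walk_pos p.1 n + val p.2 < 0)) f p.
  rewrite /overshoot_poly horner_sum; apply: eq_bigr => p _.
  by rewrite !hornerE.
rewrite nextE totalE overE; apply/eqP; rewrite eq_sym subr_eq addrC; apply/eqP.
by rewrite (bigID (fun p : n.-tuple S * S => walk_pos p.1 n + val p.2 < 0)).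
Qed.

Lemma size_overshoot_poly n : (size (overshoot_poly n) <= m)%N.
Proof.
apply: (big_ind (fun p : {poly _} => size p <= m)%N).
- by rewrite size_poly0.
- move=> p q szp szq; apply: leq_trans (size_polyD _ _) _.
  by rewrite geq_max szp.
- move=> [s a] /= /andP[/walk_pos_ge0 s0 sa0].
  apply: leq_trans (size_scale_leq _ _) _; rewrite size_polyXn.
  move: (m_min (fsvalP a)) s0 sa0 => /=.
  move: (walk_pos s n) (fsval a) => k l ml k0 kl0; lia.
Qed.

Lemma walk_poly_no_pos n : walk_poly n \is a polyOver (@no_pos F).
Proof.
by apply: rpred_sum => s _; rewrite polyOverZ ?no_posC// rpredX// polyOverX.
Qed.

Lemma walk_gf_horner n : (walk_gf S w)``_n = (walk_poly n).[x].
Proof.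
apply: puiseuxP => q; rewrite walk_gf_coef /walk_poly horner_sum pcoef_sum.
transitivity (\sum_(s : n.-tuple S | walk_in_N s)
    if q == (walk_pos s n)%:~R then walk_weight w s else 0); last first.
  apply: eq_bigr => s /walk_pos_ge0 s0; rewrite !hornerE mulr_algl pcoefZ.
  rewrite exprnP pcoefXz gez0_abs//.
  by case: eqP => _; rewrite ?mulr1 ?mulr0.
case: ifPn => [/andP[/eqP d1 q0]|nq].
  rewrite -big_mkcondr; apply: eq_bigl => s; congr (_ && _).
  rewrite -{2}[q]divq_num_den d1 divr1 eqr_int eq_sym gez0_abs//.
  by rewrite numq_ge0.
rewrite big1// => s /walk_pos_ge0 s0; case: eqP => // qE.
by case/negP: nq; rewrite qE denq_int eqxx ler0z.
Qed.
End WalkPolynomials.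

(** * Division by the kernel and remainders at the small roots *)

Section KernelExpansion.
Variables (F : fieldType) (S : {fset int}) (w : int -> F) (m : nat).
Hypothesis m_min : forall i, i \in S -> - m%:Z <= i.
Local Notation x := (pX F).

Lemma div_kernel_coef (c : puiseux F) n :
  (fpsC c / kernel S w)``_n = c * step_poly S w x ^+ n.
Proof.
pose g := Fps (fun n => c * step_poly S w x ^+ n).
suff -> : fpsC c / kernel S w = g by [].
apply: (mulIr (kernel_unit S w)); rewrite divrK ?kernel_unit//.
set s := step_poly S w x; rewrite /kernel mulrC mulrBl mul1r -mulrA.
apply: fpsP => n1; rewrite -/s.
rewrite -[RHS]/(g``_n1 - (fpsX _ * (fpsC s * g))``_n1).
case: n1 => [|k]; first by rewrite fps_coefXM0 subr0 /= mulr1.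
by rewrite fps_coefXM fps_coefCM /= mulrCA -exprS subrr.
Qed.

Section Remainders.
Variable xs : seq (puiseux F).
Hypotheses (xs_uniq : uniq xs) (size_xs : size xs = m).
Hypothesis xsP :
  forall X, X \in xs -> X != 0 /\ step_poly S w X = step_poly S w x.
Hypothesis xs_no_pos : forall X, X \in xs -> no_pos_power X.
Local Notation D := (\prod_(X <- xs) ('X - X%:P)).

Lemma walk_poly_remainder n : exists r : {poly puiseux F},
  [/\ (size r <= m)%N, r \is a polyOver (@no_pos F) &
      forall X, X \in xs -> r.[X] = X ^+ m * (walk_poly S w n).[X]].
Proof.
have [|||q [r [qE szr rno]]] := @polyOver_divp_monic _ (@no_pos F) D
  ('X^m * walk_poly S w n).
- exact: monic_prod_XsubC.
- rewrite big_seq; apply: rpred_prod => X Xxs.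
  by rewrite polyOverXsubC; apply/no_posP; exact: xs_no_pos.
- by rewrite rpredM ?walk_poly_no_pos// rpredX// polyOverX.
rewrite size_prod_XsubC size_xs ltnS in szr.
exists r; split=> // X Xxs; have := congr1 (horner^~ X) qE.
rewrite !hornerE => ->.
suff /rootP -> : root D X by rewrite mulr0 add0r.
by rewrite root_prod_XsubC.
Qed.

(** The core of the argument.  Such an r is determined by its values at the m
    points of [xs]; these show that 'X^m - r is D for n = 0, and they turn
    [walk_polyS] into the recurrence r_(n+1) = S(x) r_n - o_n, because S takes
    the value S(x) at each point. *)
Lemma walk_poly_sub_remainder n (r : {poly puiseux F}) : (size r <= m)%N ->
  (forall X, X \in xs -> r.[X] = X ^+ m * (walk_poly S w n).[X]) ->
  x ^+ m * (walk_poly S w n).[x] - r.[x] = step_poly S w x ^+ n * D.[x].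
Proof.
elim: n r => [|n IH] r szr rE.
  have szq : size ('X^m - r) = m.+1.
    by rewrite size_polyDl size_polyXn// size_polyN.
  have /(_ xs)qE := all_roots_prod_XsubC (p := 'X^m - r).
  rewrite walk_poly0 hornerC mulr1 expr0 mul1r.
  have -> : D = 'X^m - r.
    rewrite qE ?size_xs//.
    - rewrite lead_coefDl ?lead_coefXn ?scale1r//.
      by rewrite size_polyN size_polyXn.
    - apply/allP => X Xxs; rewrite rootE hornerD hornerN hornerXn rE//.
      by rewrite walk_poly0 hornerC mulr1 subrr.
    - by rewrite uniq_rootsE.
  by rewrite hornerD hornerN hornerXn.
have [r' [szr' _ r'E]] := walk_poly_remainder n.
have rrE : r = step_poly S w x *: r' - overshoot_poly S w m n.
  apply/eqP; rewrite -subr_eq0; apply/eqP.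
  apply: (@roots_geq_poly_eq0 _ _ xs).
  - apply/allP => X Xxs; have [X0 eqX] := xsP Xxs.
    rewrite rootE !hornerE (rE X Xxs) (walk_polyS w m_min n X0) (r'E X Xxs).
    by rewrite eqX subrr.
  - exact: xs_uniq.
  - rewrite size_xs; apply: leq_trans (size_polyD _ _) _; rewrite geq_max szr.
    rewrite size_polyN; apply: leq_trans (size_polyD _ _) _.
    rewrite geq_max size_polyN size_overshoot_poly// andbT.
    exact: leq_trans (size_scale_leq _ _) _.
rewrite (walk_polyS w m_min n (pX_neq0 F)) rrE hornerD hornerN hornerZ.
by rewrite exprS -mulrA -(IH r' szr' r'E) mulrBr opprB addrA subrK.
Qed.

End Remainders.

End KernelExpansion.

(** * The generating function *)

Section MainFormulas.
Variables (F : fieldType) (S : {fset int}) (w : int -> F) (m : nat).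
Hypothesis m_min : forall i, i \in S -> - m%:Z <= i.
Local Notation x := (pX F).

Lemma prod_root_factors (xs : seq (puiseux F)) :
  \prod_(X <- xs) (1 - x^-1 * X) =
  x ^- size xs * (\prod_(X <- xs) ('X - X%:P)).[x].
Proof.
rewrite horner_prod -exprVn -iter_mulr_1 -count_predT -big_const_seq.
rewrite -big_split /=; apply: eq_bigr => X _.
by rewrite hornerXsubC mulrBr mulVf// pX_neq0.
Qed.

Lemma walk_gf_root_series (xs : seq (puiseux F)) :
  uniq xs -> size xs = m ->
  (forall X, X \in xs -> X != 0 /\ step_poly S w X = step_poly S w x) ->
  (forall X, X \in xs -> no_pos_power X) ->
  walk_gf S w = fps_nonneg_part (root_series S w xs).
Proof.
move=> xs_uniq size_xs xsP xs_no.
apply: fpsP => n; rewrite walk_gf_horner.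
have [r [szr rno rE]] := walk_poly_remainder S w size_xs xs_no n.
have := walk_poly_sub_remainder m_min xs_uniq size_xs xsP xs_no szr rE.
move/eqP; rewrite subr_eq => /eqP xqE.
have xm0 : x ^+ m != 0 by rewrite expf_neq0 ?pX_neq0.
have qxE : (walk_poly S w n).[x] =
    (root_series S w xs)``_n + x ^- m * r.[x].
  apply: (mulfI xm0); rewrite xqE mulrDr mulVKf// /root_series div_kernel_coef.
  by rewrite prod_root_factors size_xs mulrA mulVKf// mulrC.
(* x ^- m * r.[x] has only negative exponents, and the polynomial has none. *)
apply: puiseuxP => q1; rewrite /fps_nonneg_part /=.
case: ifPn => [q0|q0].
  by rewrite qxE pcoefD (horner_pX_low szr rno q0) addr0.
by rewrite -walk_gf_horner walk_gf_coef (negbTE q0) andbF.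
Qed.

Lemma deriv_step_poly_clear : x ^+ m.+1 * deriv_step_poly S w x =
  \sum_(i <- S) (w i * i%:~R) *: x ^+ absz (i + m%:Z)%R.
Proof.
rewrite mulr_sumr [LHS]big_seq [RHS]big_seq; apply: eq_bigr => i iS.
rewrite -(exprz_mul_exprn (pX_neq0 F) (m_min iS)) -scalerAr; congr (_ *: _).
rewrite exprS -mulrA mulrCA [in LHS]mulrC; congr (_ * _).
by rewrite -[X in X * _]expr1z -expfzDr ?pX_neq0// addrC subrK.
Qed.

Lemma step_poly_clear : x ^+ m * step_poly S w x =
  \sum_(i <- S) w i *: x ^+ absz (i + m%:Z)%R.
Proof.
rewrite mulr_sumr [LHS]big_seq [RHS]big_seq; apply: eq_bigr => i iS.
rewrite -(exprz_mul_exprn (pX_neq0 F) (m_min iS)) -scalerAr.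
by congr (_ *: _); rewrite mulrC.
Qed.

(** Multiplying numerator and denominator by x^(m+1) makes them polynomials in
    x and t. *)
Lemma fps_rational_div_kernel (c : F) : c != 0 ->
  fps_rational (fpsC (deriv_step_poly S w x) / (fpsC c%:A * kernel S w)).
Proof.
move=> c0.
pose s (a : int -> F) : {poly F} := \sum_(i <- S) a i *: 'X^(absz (i + m%:Z)%R).
have sE a : horner_alg x (s a) = \sum_(i <- S) a i *: x ^+ absz (i + m%:Z)%R.
  rewrite raddf_sum /=; apply: eq_bigr => i _.
  by rewrite linearZ /= rmorphXn /= horner_algX mulr_algl.
pose b0 : {poly F} := c *: 'X^(m.+1).
pose b1 : {poly F} := c *: ('X * s w).
have b0E : horner_alg x b0 = c%:A * x ^+ m.+1.
  by rewrite linearZ /= rmorphXn /= horner_algX.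
have b1E : horner_alg x b1 = c%:A * x ^+ m.+1 * step_poly S w x.
  rewrite linearZ /= rmorphM /= horner_algX sE -step_poly_clear.
  by rewrite [x * _]mulrA -exprS mulrA.
exists (s (fun i => w i * i%:~R))%:P, (b0%:P - b1%:P * 'X); split.
  apply: contraNneq c0 => /(congr1 (fun p : {poly {poly F}} => p`_0`_m.+1)).
  rewrite coefB coefMX !coefC /= subr0 => /eqP.
  by rewrite coefZ coefXn eqxx mulr1.
have BE : fps_of_poly2 (b0%:P - b1%:P * 'X) =
    fpsC (x ^+ m.+1) * (fpsC c%:A * kernel S w).
  rewrite mulrA -rmorphM /= /kernel mulrBr mulr1 mulrCA -rmorphM /=.
  apply: fpsP => n; set u := fpsX _ * _.
  rewrite -[RHS]/((fpsC (x ^+ m.+1 * c%:A))``_n - u``_n) /u.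
  rewrite -[LHS]/((map_poly _ _)`_n) coef_map coefB coefMX !coefC.
  case: n => [|[|n]].
  - by rewrite fps_coefXM0 !subr0 -[LHS]/(horner_alg x b0) b0E mulrC.
  - by rewrite fps_coefXM /= !sub0r rmorphN /= b1E [c%:A * _]mulrC.
  - by rewrite fps_coefXM /= !subr0 rmorph0.
have AE : fps_of_poly2 (s (fun i => w i * i%:~R))%:P =
    fpsC (x ^+ m.+1 * deriv_step_poly S w x).
  apply: fpsP => n; rewrite deriv_step_poly_clear -sE.
  rewrite /fps_of_poly2 /= coef_map /= coefC.
  by case: eqP => // _; rewrite rmorph0.
have ker_unit : fpsC c%:A * kernel S w \is a GRing.unit.
  rewrite unitrM kernel_unit andbT; apply: rmorph_unit.
  by rewrite unitfE scaler_eq0 oner_eq0 orbF.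
rewrite BE AE -mulrA [X in _ * X]mulrC (divrK ker_unit).
by rewrite rmorphM.
Qed.

(** The derivative of X^m (S(X) - S(x)) at X = x, where the second factor
    vanishes, is x^m S'(x).  The extra factor x keeps all exponents
    non-negative. *)
Lemma deriv_step_eq_poly :
  x * (step_eq_poly S w m)^`().[x] = x ^+ m.+1 * deriv_step_poly S w x.
Proof.
rewrite /step_eq_poly derivB derivZ derivXn raddf_sum /=.
rewrite hornerD hornerN hornerZ hornerMn hornerXn horner_sum mulrC mulrBl.
rewrite -mulrA mulrn_exprp mulrnAr [_ * x ^+ m]mulrC step_poly_clear.
rewrite deriv_step_poly_clear mulr_suml -sumrMnl -sumrB.
rewrite [LHS]big_seq [RHS]big_seq; apply: eq_bigr => i iS.
rewrite derivZ derivXn hornerZ hornerMn hornerXn -mulrA mulrn_exprp mulr_algl.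
set y := x ^+ _; set k := absz _.
have -> : i = k%:Z - m%:Z.
  by rewrite /k gez0_abs ?addrK//; have := m_min iS; lia.
rewrite rmorphB /= mulrBr scalerBl -!pmulrn.
by rewrite -!scalerA !scaler_nat !scalerMnr.
Qed.

End MainFormulas.

Theorem proposition19 (F : closedFieldType) (charF0 : [pchar F] =i pred0)
    (S : {fset int}) (w : int -> F) (w_neq0 : forall i, i \in S -> w i != 0)
    (m M : nat)
    (m_in : - m%:Z \in S) (m_min : forall i, i \in S -> - m%:Z <= i)
    (M_in : M%:Z \in S) (M_max : forall i, i \in S -> i <= M%:Z)
    (M_gt0 : (0 < M)%N) :
  exists (xs : m.-tuple (puiseux F)) (ys : M.-tuple (puiseux F)),
    [/\ uniq (xs ++ ys)
          /\ (forall X : puiseux F, X \in xs ++ ys <->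
                X != 0 /\ step_poly S w X = step_poly S w (pX F)),
        forall X : puiseux F, X \in xs ++ ys -> (X \in xs <-> no_pos_power X),
        forall X : puiseux F, X \in (xs : seq _) -> pcoef X 0 = 0,
        walk_gf S w = fps_nonneg_part (root_series S w xs)
      & M = 1%N ->
          fps_rational (root_series S w xs) /\
          walk_gf S w = fps_nonneg_part (deriv_series S w)].
Proof.
have [xs [ys [xys_uniq xysP xs_neg ys_pos prodE]]] :=
  step_equation_roots charF0 w_neq0 m_in m_min M_in M_max M_gt0.
have xs_no X : X \in xs -> no_pos_power X.
  by move=> Xxs q /ltW; exact: xs_neg.
have xs_uniq : uniq xs by move: xys_uniq; rewrite cat_uniq => /and3P[].
have xsP X : X \in xs -> X != 0 /\ step_poly S w X = step_poly S w (pX F).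
  by move=> Xxs; apply/xysP; rewrite mem_cat Xxs.
have walkE := walk_gf_root_series m_min xs_uniq (size_tuple xs) xsP xs_no.
exists xs, ys; split.
- exact: (conj xys_uniq xysP).
- move=> X Xxys; split=> [/xs_no//|Xno].
  move: Xxys; rewrite mem_cat => /orP[//|/ys_pos/eqP[]].
  by apply: Xno; exact: ltr01.
- by move=> X /xs_neg; apply.
- exact: walkE.
move=> M1; rewrite M1 in ys ys_pos xysP prodE xys_uniq M_in *.
have x_notin : pX F \notin xs.
  apply/negP => /xs_no/(_ 1 ltr01) /eqP.
  by rewrite [_ == _]oner_eq0.
have ysE : ys = [:: pX F] :> seq _.
  have : pX F \in xs ++ ys by apply/xysP; split=> //; exact: pX_neq0.
  rewrite mem_cat (negbTE x_notin) /=.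
  by case: (ys) => -[|y [|//]] //= _; rewrite inE => /eqP ->.
have w1 : (w 1)%:A != 0 :> puiseux F.
  by rewrite scaler_eq0 oner_eq0 orbF; exact: w_neq0.
pose D := \prod_(X <- xs) ('X - X%:P).
have derivD : pX F ^+ m * deriv_step_poly S w (pX F) = (w 1)%:A * D.[pX F].
  apply: (mulfI (pX_neq0 F)); rewrite mulrA -exprS.
  rewrite -(deriv_step_eq_poly w m_min).
  congr (_ * _); rewrite prodE big_cat ysE big_seq1 /= derivZ hornerZ.
  congr (_ * _); rewrite derivM derivXsubC !hornerE subrr.
  by rewrite mulr0 add0r.
have seriesE : root_series S w xs = deriv_series S w.
  rewrite /root_series /deriv_series prod_root_factors size_tuple -/D.
  have -> : D.[pX F] =
      (w 1)%:A^-1 * (pX F ^+ m * deriv_step_poly S w (pX F)).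
    by rewrite derivD (mulKf w1).
  have xm0 : pX F ^+ m != 0 by rewrite expf_neq0 ?pX_neq0.
  rewrite mulrCA (mulKf xm0) [(w 1)%:A^-1 * _]mulrC.
  have uw : fpsC ((w 1)%:A : puiseux F) \is a GRing.unit.
    by apply: rmorph_unit; rewrite unitfE.
  rewrite -[X in _ = fpsC X / _](divfK w1) [in RHS]rmorphM.
  rewrite (invrM uw (kernel_unit S w)) [X in _ = _ * X]mulrC mulrA.
  by rewrite (mulrK uw).
rewrite -seriesE; split; last exact: walkE.
rewrite seriesE; apply: (fps_rational_div_kernel w m_min).
exact: w_neq0.
Qed.
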